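(* Let $\mathcal E$ be a nonlinear Dirichlet form on $L^2(\mu)$ satisfying the weak $\Delta_2$-condition. The following are equivalent: (i) $\mathcal E$ is critical; (ii) $1\in M(\mathcal E_e)$ and $\|1\|_{L_e}=0$; (iii) there exists a sequence $(e_n)$ in $M(\mathcal E)$ with $0\le e_n\le1$, $e_n\to1$ locally in measure and $\|e_n\|_L\to0$.
   Context: $(X,\mathfrak A,\mu)$ is $\sigma$-finite; $L^0(\mu)$ carries local convergence in measure. A nonlinear Dirichlet form is a lower semicontinuous convex $\mathcal E\colon L^2(\mu)\to[0,\infty]$ with $\mathcal E(-f)=\mathcal E(f)$, $\mathcal E(0)=0$, such that $\mathcal E(f+Cg)+\mathcal E(f-Cg)\le\mathcal E(f+g)+\mathcal E(f-g)$ for all $f,g$ and all 1-Lipschitz $C\colon\mathbb R\to\mathbb R$ with $C(0)=0$. Weak $\Delta_2$-condition: $\mathcal E(f_n)\to0$ implies $\mathcal E(2f_n)\to0$. $M(\mathcal E)$, $\|\cdot\|_L$: modular space $\{f:\lim_{\lambda\to0+}\mathcal E(\lambda f)=0\}$ and Luxemburg seminorm $\inf\{\lambda>0:\mathcal E(\lambda^{-1}f)\le1\}$; $\mathcal E_e$ is the lower semicontinuous relaxation on $L^0(\mu)$ of $\mathcal E$ extended by $+\infty$, with $M(\mathcal E_e)$, $\|\cdot\|_{L_e}$ analogous. Resolvent $G_\alpha f$ minimizes $g\mapsto\mathcal E(g)+\frac\alpha2\|g-\alpha^{-1}f\|_2^2$, extended to nonnegative functions by monotone limits; Green operator $Gf=\lim_{\alpha\to0+}G_\alpha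 f$. $\mathcal E$ is critical if for every $f\in L^1_+(\mu)$ one has $\mu(\{f>0\}\cap\{Gf<\infty\})=0$. *)

(* Defs.v *)
From HB Require Import structures.
From mathcomp Require Import all_boot all_order all_algebra.
From mathcomp Require Import all_classical all_reals all_analysis.
From Stdlib Require Import ClassicalEpsilon.

Set Implicit Arguments.
Unset Strict Implicit.
Unset Printing Implicit Defensive.

Import Order.TTheory GRing.Theory Num.Theory.
Import numFieldNormedType.Exports.
Local Open Scope classical_set_scope.
Local Open Scope ring_scope.

Section Defs.
Context (d : measure_display) (T : measurableType d) (R : realType).
Variable mu : {measure set T -> \bar R}.

Definition L2 (f : T -> R) : Prop :=
  measurable_fun setT f /\ (\int[mu]_x ((f x) ^+ 2)%:E < +oo)%E.

Definition dist2 (f g : T -> R) : \bar R := \int[mu]_x ((f x - g x) ^+ 2)%:E.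

(* A functional on L^2(mu), encoded on representatives, extended by +oo
   outside L^2 and invariant under a.e. equality. *)
Record nonlinear_Dirichlet_form (E : (T -> R) -> \bar R) : Prop := {
  ndf_outside : forall f, ~ L2 f -> E f = +oo%E;
  ndf_ae : forall f g, L2 f -> L2 g -> {ae mu, forall x, f x = g x} -> E f = E g;
  ndf_ge0 : forall f, (0 <= E f)%E;
  ndf_lsc : forall (u : nat -> T -> R) f, (forall n, L2 (u n)) -> L2 f ->
          (fun n => dist2 (u n) f) @ \oo --> 0%E ->
          (E f <= limn_einf (fun n => E (u n)))%E;
  ndf_convex : forall f g (t : R), 0 <= t <= 1 ->
          (E (fun x => (t * f x + (1 - t) * g x)%R)
             <= t%:E * E f + (1 - t)%R%:E * E g)%E;
  ndf_sym : forall f, E (fun x => - f x) = E f;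
  ndf_0 : E (fun _ => 0) = 0%E;
  ndf_contr : forall f g (C : R -> R),
          (forall a b, `|C a - C b| <= `|a - b|) -> C 0 = 0 ->
          (E (fun x => (f x + C (g x))%R) + E (fun x => (f x - C (g x))%R)
             <= E (fun x => (f x + g x)%R) + E (fun x => (f x - g x)%R))%E }.

Definition weak_Delta2 (E : (T -> R) -> \bar R) : Prop :=
  forall u : nat -> T -> R,
    (fun n => E (u n)) @ \oo --> 0%E ->
    (fun n => E (fun x => 2 * u n x)) @ \oo --> 0%E.

Definition loc_cvg_meas (u : nat -> T -> R) (f : T -> R) : Prop :=
  forall A, measurable A -> (mu A < +oo)%E ->
    forall eps : R, 0 < eps ->
      (fun n => mu (A `&` [set x | eps < `|u n x - f x|])) @ \oo --> 0%E.

(* lower semicontinuous relaxation on L^0 (local convergence in measure,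
   a metrizable topology, so sequences suffice) of E extended by +oo *)
Definition ext_form (E : (T -> R) -> \bar R) (f : T -> R) : \bar R :=
  ereal_inf [set limn_einf (fun n => E (u n)) | u in
     [set u : nat -> T -> R | (forall n, measurable_fun setT (u n)) /\
                              loc_cvg_meas u f]].

Definition modular (F : (T -> R) -> \bar R) (f : T -> R) : Prop :=
  (fun l : R => F (fun x => l * f x)) @ 0^'+ --> 0%E.

Definition luxemburg (F : (T -> R) -> \bar R) (f : T -> R) : \bar R :=
  ereal_inf [set l%:E | l in [set l : R | 0 < l /\ (F (fun x => (l^-1 * f x)%R) <= 1)%E]].

Definition resolvent_min (E : (T -> R) -> \bar R) (alpha : R) (f g : T -> R) : Prop :=
  L2 g /\ forall h, L2 h ->
    (E g + (alpha / 2)%R%:E * dist2 g (fun x => (alpha^-1 * f x)%R)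
       <= E h + (alpha / 2)%R%:E * dist2 h (fun x => (alpha^-1 * f x)%R))%E.

Definition resolvent (E : (T -> R) -> \bar R) (alpha : R) (f : T -> R) : T -> R :=
  epsilon (inhabits (fun _ : T => 0)) (resolvent_min E alpha f).

(* extension to nonnegative f (here f in L^1_+) by monotone limits,
   along the L^2 approximations min(f, n) increasing to f *)
Definition resolvent_pos (E : (T -> R) -> \bar R) (alpha : R) (f : T -> R)
  : T -> \bar R :=
  fun x => limn_esup (fun n : nat =>
             (resolvent E alpha (fun y => Num.min (f y) n%:R) x)%:E).

(* Green operator G f = lim_{alpha -> 0+} G_alpha f (along alpha = 1/(k+1)) *)
Definition green (E : (T -> R) -> \bar R) (f : T -> R) : T -> \bar R :=
  fun x => limn_esup (fun k : nat => resolvent_pos E (k.+1%:R)^-1 f x).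

Definition critical (E : (T -> R) -> \bar R) : Prop :=
  forall f : T -> R, measurable_fun setT f -> (forall x, 0 <= f x) ->
    mu.-integrable setT (fun x => (f x)%:E) ->
    mu ([set x | 0 < f x] `&` [set x | (green E f x < +oo)%E]) = 0%E.

End Defs.

(* Main.v *)
Require Import Defs.
From HB Require Import structures.
From mathcomp Require Import all_boot all_order all_algebra.
From mathcomp Require Import all_classical all_reals all_analysis.
From mathcomp Require Import measurable_realfun ring lra.

Import Order.TTheory GRing.Theory Num.Theory.
Import numFieldNormedType.Exports.
Local Open Scope classical_set_scope.
Local Open Scope ring_scope.

Set Implicit Arguments.
Unset Strict Implicit.
Unset Printing Implicit Defensive.

(** Write [J g = E g + alpha/2 ||g - f/alpha||^2] for the functional minimized by
[resolvent alpha f]; it has a minimizer, unique up to null sets, by uniform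
convexity and completeness of [L^2]. Contractions of the minimizer give order
properties: [|.|] yields monotonicity in [f] and in [1/alpha], and the maximum
principle follows by truncating at the supremum over the support of [f].

All three conditions are equivalent to the existence of cutoffs: for all [lam], [eps]
and every set [A] of finite measure there is [0 <= v <= 1] with [E (lam v) <= eps]
and [v] close to [1] on [A].

If [E] is critical, take [f = c 1_A]. Its resolvents [g] increase to infinity on [A],
and comparing [J g] with [J (g - g /\ lam)] gives [E (g /\ lam) <= lam * c * mu A],
so [v = (g /\ lam) / lam] is a cutoff once [c] is small. Conversely, if the Green
function of [f] is finite on a non-null part of [{f > 0}], then for some [c], [m] and
non-null [A] the resolvents [g] of [c 1_A <= f] are bounded by [m] on [A], hence
everywhere; comparing [J g] with [J (lam v)] and letting [alpha] tend to [0] gives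
[lam * c * \int_A v <= E (lam v) + m * c * mu A], which cutoffs violate for large
[lam]. *)

(** * Square-integrable functions and the squared distance [dist2] *)

Section toolbox.
Context (d : measure_display) (T : measurableType d) (R : realType).
Variable mu : {measure set T -> \bar R}.
Implicit Types f g h : T -> R.

(** Sums of nonnegative terms on both sides let pointwise inequalities with negative terms be
    integrated after moving those terms across, with no subtraction of possibly infinite
    integrals. *)
Lemma ae_le_integralD (a b c e : T -> R) :
  measurable_fun setT a -> measurable_fun setT b ->
  measurable_fun setT c -> measurable_fun setT e ->
  (forall x, 0 <= a x) -> (forall x, 0 <= b x) ->
  (forall x, 0 <= c x) -> (forall x, 0 <= e x) ->
  {ae mu, forall x, a x + b x <= c x + e x} ->
  (\int[mu]_x (a x)%:E + \int[mu]_x (b x)%:E <=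
   \int[mu]_x (c x)%:E + \int[mu]_x (e x)%:E)%E.
Proof.
move=> ma mb mc me a0 b0 c0 e0 H.
have ? : measurable_fun setT (fun x => (a x)%:E) by exact/measurable_EFinP.
have ? : measurable_fun setT (fun x => (b x)%:E) by exact/measurable_EFinP.
have ? : measurable_fun setT (fun x => (c x)%:E) by exact/measurable_EFinP.
have ? : measurable_fun setT (fun x => (e x)%:E) by exact/measurable_EFinP.
rewrite -!ge0_integralD//; try by move=> x _; rewrite lee_fin.
apply: ae_ge0_le_integral => //.
- by move=> x _; rewrite -EFinD lee_fin addr_ge0.
- exact: emeasurable_funD.
- by move=> x _; rewrite -EFinD lee_fin addr_ge0.
- exact: emeasurable_funD.
by apply: filterS H => x H _; rewrite -!EFinD lee_fin.
Qed.

Lemma measurable_sqB f g (c : R) : measurable_fun setT f -> measurable_fun setT g ->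
  measurable_fun setT (fun x => c * (f x - g x) ^+ 2).
Proof.
move=> mf mg; apply: measurable_funM => //.
by apply: measurable_funX; exact: measurable_funB.
Qed.

Lemma scale_dist2 f g (c : R) : measurable_fun setT f -> measurable_fun setT g ->
  0 <= c -> (c%:E * dist2 mu f g = \int[mu]_x (c * (f x - g x) ^+ 2)%:E)%E.
Proof.
move=> mf mg c0; rewrite /dist2 -ge0_integralZl_EFin//.
- by move=> x _; rewrite lee_fin sqr_ge0.
- apply/measurable_EFinP; apply: measurable_funX; exact: measurable_funB.
Qed.

Lemma dist2_ge0 f g : (0 <= dist2 mu f g)%E.
Proof. by apply: integral_ge0 => x _; rewrite lee_fin sqr_ge0. Qed.

Lemma L2_le (c : R) f g h : L2 mu f -> L2 mu g -> measurable_fun setT h ->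
  (forall x, h x ^+ 2 <= c * f x ^+ 2 + c * g x ^+ 2) -> 0 <= c -> L2 mu h.
Proof.
move=> [mf If] [mg Ig] mh H c0; split=> //.
have X (k : T -> R) : measurable_fun setT k -> measurable_fun setT (fun x => c * k x ^+ 2).
  by move=> mk; apply: measurable_funM => //; exact: measurable_funX.
have P (k : T -> R) x : 0 <= c * k x ^+ 2 :> R by rewrite mulr_ge0// sqr_ge0.
have := @ae_le_integralD (fun x => h x ^+ 2) (fun=> 0) (fun x => c * f x ^+ 2)
  (fun x => c * g x ^+ 2) (measurable_funX 2 mh) (measurable_cst _) (X _ mf) (X _ mg)
  (fun x => sqr_ge0 _) (fun=> lexx _) (P f) (P g) _.
rewrite integral0 adde0 => /(_ _)/le_lt_trans; apply.
  by apply: aeW => x; rewrite addr0.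
have Y (k : T -> R) : measurable_fun setT k -> (\int[mu]_x (k x ^+ 2)%:E < +oo)%E ->
    (\int[mu]_x (c * k x ^+ 2)%:E < +oo)%E.
  move=> mk Ik; under eq_integral do rewrite EFinM.
  rewrite ge0_integralZl_EFin//.
  - by rewrite lte_mul_pinfty.
  - by move=> x _; rewrite lee_fin sqr_ge0.
  - by apply/measurable_EFinP; exact: measurable_funX.
by rewrite lte_add_pinfty// Y.
Qed.

Lemma L2_0 : L2 mu (fun=> 0).
Proof. by split=> //; under eq_integral do rewrite expr0n/=; rewrite integral0. Qed.

Lemma L2D f g (a b : R) : L2 mu f -> L2 mu g -> L2 mu (fun x => a * f x + b * g x).
Proof.
move=> f2 g2; apply: (L2_le (c := 2 * a ^+ 2 + 2 * b ^+ 2) f2 g2) => [|x|].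
- have [? _] := f2; have [? _] := g2.
  by apply: measurable_funD; exact: measurable_funM.
- have := sqr_ge0 (a * f x - b * g x).
  have := sqr_ge0 (a * g x); have := sqr_ge0 (b * f x); nra.
- by have := sqr_ge0 a; have := sqr_ge0 b; lra.
Qed.

Lemma L2Z f (a : R) : L2 mu f -> L2 mu (fun x => a * f x).
Proof.
move=> f2; have := L2D a 0 f2 f2; congr (L2 _ _).
by apply/funext => x; rewrite mul0r addr0.
Qed.

Lemma L2_dom f h : L2 mu f -> measurable_fun setT h -> (forall x, `|h x| <= `|f x|) ->
  L2 mu h.
Proof.
move=> f2 mh H; apply: (L2_le (c := 1) f2 f2) => // x.
rewrite -[h x ^+ 2]ger0_norm ?sqr_ge0// normrX -[f x ^+ 2]ger0_norm ?sqr_ge0// normrX.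
have := H x; have := normr_ge0 (h x); have := normr_ge0 (f x); nra.
Qed.

Lemma dist2_fin f g : L2 mu f -> L2 mu g -> (dist2 mu f g < +oo)%E.
Proof.
move=> f2 g2; have [_] := L2D 1 (-1) f2 g2; apply: le_lt_trans.
rewrite le_eqVlt; apply/orP; left; apply/eqP; apply: eq_integral => x _.
by rewrite mul1r mulN1r.
Qed.

Lemma dist2_eq0 f g : L2 mu f -> L2 mu g -> (dist2 mu f g <= 0)%E ->
  {ae mu, forall x, f x = g x}.
Proof.
move=> f2 g2 H.
have [mf _] := f2; have [mg _] := g2.
have m : measurable_fun setT (fun x => ((f x - g x) ^+ 2)%:E).
  by apply/measurable_EFinP; apply: measurable_funX; exact: measurable_funB.
have [/(_ _) + _] := @ae_eq_integral_abs _ _ _ mu setT measurableT _ m.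
case.
  apply/eqP; rewrite eq_le integral_ge0// andbT; apply: le_trans H.
  by rewrite /dist2; under eq_integral do rewrite gee0_abs ?lee_fin ?sqr_ge0//.
move=> N [mN N0 sN]; exists N; split=> // x /= nfg; apply: sN => /=; apply: contra_not nfg.
by move=> /(_ I)/= [] /eqP; rewrite sqrf_eq0 subr_eq0 => /eqP.
Qed.
End toolbox.

(** * Upper and lower limits of extended real sequences *)

Section limits.
Context (R : realType).
Implicit Types v : nat -> \bar R.

Lemma limn_esup_le v (c : \bar R) (N : nat) :
  (forall p, (N <= p)%N -> (v p <= c)%E) -> (limn_esup v <= c)%E.
Proof.
move=> H; rewrite /limn_esup limf_esupE.
apply: (@le_trans _ _ (ereal_sup (v @` [set p | (N <= p)%N]))).
  by apply: ereal_inf_lbound; exists [set p | (N <= p)%N] => //; exists N.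
by apply: ge_ereal_sup => _ [p /= Np <-]; exact: H.
Qed.

Lemma limn_einf_le v (c : \bar R) (N : nat) :
  (forall p, (N <= p)%N -> (v p <= c)%E) -> (limn_einf v <= c)%E.
Proof. by move=> H; apply: (le_trans (limn_einf_sup v)); exact: limn_esup_le H. Qed.

Lemma limn_einf_ge v (c : \bar R) (N : nat) :
  (forall p, (N <= p)%N -> (c <= v p)%E) -> (c <= limn_einf v)%E.
Proof.
move=> H; rewrite /limn_einf leeNr; apply: (@limn_esup_le _ _ N) => p Np /=.
by rewrite leeN2 H.
Qed.

Lemma limn_esup_ge v (c : \bar R) (N : nat) :
  (forall p, (N <= p)%N -> (c <= v p)%E) -> (c <= limn_esup v)%E.
Proof. by move=> H; apply: le_trans (limn_einf_sup v); exact: limn_einf_ge H. Qed.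

Lemma le_limn_esup v w (N : nat) :
  (forall p, (N <= p)%N -> (v p <= w p)%E) -> (limn_esup v <= limn_esup w)%E.
Proof.
move=> H; rewrite {2}/limn_esup limf_esupE; apply: le_ereal_inf_tmp => _ [V [M _ MV] <-].
apply: (@limn_esup_le _ _ (maxn N M)) => p; rewrite geq_max => /andP[Np Mp].
by apply: (le_trans (H p Np)); apply: ereal_sup_ubound; exists p => //; exact: MV.
Qed.

Lemma limn_einf_lt v (c : \bar R) (N : nat) :
  (limn_einf v < c)%E -> exists2 n, (N <= n)%N & (v n < c)%E.
Proof.
move=> H; apply: contrapT => K; move: H; apply/negP; rewrite -leNgt.
apply: (@limn_einf_ge _ _ N) => p Np; rewrite leNgt; apply/negP => vp.
by apply: K; exists p.
Qed.

Lemma cvge0_small v (e : R) : v @ \oo --> 0%E -> 0 < e ->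
  exists N : nat, forall n, (N <= n)%N -> (v n < e%:E)%E.
Proof.
move=> /fine_cvgP[[N1 _ H1] /cvgrPdist_lt H2] e0.
have [N2 _ {}H2] := H2 e e0.
exists (maxn N1 N2) => n; rewrite geq_max => /andP[n1 n2].
rewrite -[v n]fineK; last exact: H1.
have := H2 n n2 => /=; rewrite sub0r normrN lte_fin; exact: le_lt_trans (ler_norm _).
Qed.

Lemma cvge0_squeeze v (w : nat -> R) : (forall n, (0 <= v n)%E) ->
  (forall n, (v n <= (w n)%:E)%E) -> w @ \oo --> 0 -> v @ \oo --> 0%E.
Proof.
move=> v0 vw w0; apply: (@squeeze_cvge _ _ _ _ (fun=> 0%E) _ (fun n => (w n)%:E)).
- by apply: nearW => n; rewrite v0 vw.
- exact: cvg_cst.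
- by apply: cvg_EFin => //; apply: nearW.
Qed.

Lemma expr_small (z c e : R) : 0 <= z < 1 -> 0 < e ->
  exists N : nat, forall n, (N <= n)%N -> c * z ^+ n <= e.
Proof.
move=> /andP[z0 z1] e0.
have /cvgrPdist_le/(_ e e0)[N _ H] : geometric c z x @[x --> \oo] --> 0.
  by apply: cvg_geometric; rewrite ger0_norm.
exists N => n /H; rewrite sub0r normrN /=; exact: le_trans (ler_norm _).
Qed.

End limits.

(** * Completeness of [L2] along fast Cauchy sequences *)

Section L2_complete.
Context (d : measure_display) (T : measurableType d) (R : realType).
Variable mu : {measure set T -> \bar R}.

Lemma sqr_bound_cvg (u : nat -> R) (C : R) :
  (forall n, 4 ^+ n * (u n.+1 - u n) ^+ 2 <= C) -> cvgn u.
Proof.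
move=> H; have C0 : 0 <= C by apply: le_trans (H 0%N); rewrite mulr_ge0// sqr_ge0.
(* [C + 1] stands in for the square root of [C], since [C <= (C + 1) ^+ 2]; the series of increments
   is then dominated by a geometric one. *)
have h n : `|u n.+1 - u n| <= (C + 1) * 2^-1 ^+ n.
  rewrite exprVn ler_pdivlMr ?exprn_gt0// -[X in X <= _]ger0_norm//.
  rewrite -ler_sqr ?nnegrE//; last by lra.
  have := H n; rewrite -[4]/(2 * 2)%:R natrM -expr2 exprAC => Hn.
  rewrite ger0_norm ?mulr_ge0 ?exprn_ge0// exprMn -normrX ger0_norm ?sqr_ge0//.
  by rewrite mulrC; apply: le_trans Hn _; nra.
rewrite (_ : u = (fun n => u 0%N + series (telescope u) n)); last first.
  by apply/funext => n; exact: eq_sum_telescope.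
apply: is_cvgD; first exact: is_cvg_cst.
apply: normed_cvg; apply: (@series_le_cvg _ _ (geometric (C + 1) 2^-1)).
- by move=> n; exact: normr_ge0.
- by move=> n; rewrite /= mulr_ge0 ?exprn_ge0//; lra.
- exact: h.
- by apply: is_cvg_geometric_series; rewrite ger0_norm//; lra.
Qed.

(** The series of the squared increments weighted by [4 ^+ n] has a finite integral, so it is finite
    almost everywhere. Where it is finite, its sum bounds every term, which is the hypothesis of
    [sqr_bound_cvg]. *)
Lemma ae_cvg_of_fast_cauchy (u : nat -> T -> R) : (forall n, L2 mu (u n)) ->
  (forall n, (dist2 mu (u n.+1) (u n) <= ((16^-1) ^+ n)%:E)%E) ->
  {ae mu, forall x, cvgn (u ^~ x)}.
Proof.
move=> u2 H.
pose F n x := (4 ^+ n * (u n.+1 x - u n x) ^+ 2)%:E : \bar R.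
have F0 n x : (0 <= F n x)%E by rewrite lee_fin mulr_ge0// sqr_ge0.
have mF n : measurable_fun setT (F n).
  by apply/measurable_EFinP; apply: measurable_sqB; [have [] := u2 n.+1|have [] := u2 n].
(* The true bound [4^-n] is weakened to [2 / 2^(n+1)], the shape summed by [epsilon_trick0]. *)
have IF n : (\int[mu]_x F n x <= ((2 : R) / (2 ^ n.+1)%:R)%:E)%E.
  rewrite -scale_dist2//; [|by have [] := u2 n.+1|by have [] := u2 n].
  apply: (@le_trans _ _ ((4 ^+ n)%:E * ((16^-1) ^+ n)%:E)%E).
    by apply: lee_wpmul2l => //; rewrite lee_fin.
  rewrite -EFinM lee_fin -exprMn natrX exprS invfM mulrA divff// mul1r -exprVn.
  apply: lerXn2r; rewrite ?nnegrE//; lra.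
pose S x := (\sum_(0 <= n <oo) F n x)%E.
have S0 x : (0 <= S x)%E by apply: nneseries_ge0.
have iS : mu.-integrable setT S.
  apply/integrableP; split.
    by apply: ge0_emeasurable_sum => // n x _ _; exact: F0.
  under eq_integral do rewrite gee0_abs//.
  rewrite /S integral_nneseries//.
  apply: (@le_lt_trans _ _ (\sum_(0 <= n <oo) ((2 : R) / (2 ^ n.+1)%:R)%:E)%E).
    by apply: lee_nneseries => // n _ _; exact: integral_ge0.
  by apply: le_lt_trans (epsilon_trick0 _ _) _ => //; exact: ltry.
apply: filterS (integrable_ae measurableT iS) => x /(_ I) Sfin.
apply: (@sqr_bound_cvg _ (fine (S x))) => n.
rewrite -lee_fin fineK// -[leLHS]/(F n x).
have := @nneseries_lim_ge R (F ^~ x) xpredT 0 n.+1 (fun n _ _ => F0 n x).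
apply: le_trans; rewrite big_nat_recr//= leeDr//.
by apply: sume_ge0.
Qed.

Lemma L2_complete (u : nat -> T -> R) : (forall n, L2 mu (u n)) ->
  (forall n p, (n <= p)%N -> (dist2 mu (u n) (u p) <= ((16^-1) ^+ n)%:E)%E) ->
  exists g, L2 mu g /\ forall n, (dist2 mu (u n) g <= ((16^-1) ^+ n)%:E)%E.
Proof.
move=> u2 H.
have mu_ n : measurable_fun setT (u n) by have [] := u2 n.
have ae_cvg : {ae mu, forall x, cvgn (u ^~ x)}.
  apply: ae_cvg_of_fast_cauchy => // n; apply: le_trans (H n n.+1 (leqnSn _)).
  rewrite le_eqVlt; apply/orP; left; apply/eqP; apply: eq_integral => x _.
  by congr EFin; ring.
(* An upper limit is measurable without any convergence assumption. Where the sequence converges,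
   hence almost everywhere, [g] is its limit. *)
pose g x := fine (limn_esup (fun n => (u n x)%:E)).
have mg : measurable_fun setT g.
  apply: (measurableT_comp (f := fine)); first exact: fine_measurable.
  by apply: measurable_fun_limn_esup => n; exact/measurable_EFinP.
have gE x : cvgn (u ^~ x) -> u n x @[n --> \oo] --> g x.
  move=> cu; have -> : g x = limn (u ^~ x); last exact: cu.
  have : (u n x)%:E @[n --> \oo] --> (limn (u ^~ x))%:E by apply: cvg_EFin => //; apply: nearW.
  by move=> /cvg_limn_einf_sup[_]; rewrite /g => ->.
have Hg n : (dist2 mu (u n) g <= ((16^-1) ^+ n)%:E)%E.
  have mD p : measurable_fun setT (fun x => ((u n x - u p x) ^+ 2)%:E : \bar R).
    by apply/measurable_EFinP; apply: measurable_funX; exact: measurable_funB.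
  (* Fatou's lemma in [p] with [n] fixed: the Cauchy bound passes to the limit [g] unchanged. *)
  apply: (@le_trans _ _ (\int[mu]_x limn_einf (fun p => ((u n x - u p x) ^+ 2)%:E))%E).
    apply: ae_ge0_le_integral => //.
    - by move=> x _; rewrite lee_fin sqr_ge0.
    - by apply/measurable_EFinP; apply: measurable_funX; exact: measurable_funB.
    - by move=> x _; apply: (@limn_einf_ge _ _ _ 0) => p _; rewrite lee_fin sqr_ge0.
    - apply: measurableT_comp => //.
      apply: (measurable_fun_limn_esup (f := fun p x => - ((u n x - u p x) ^+ 2)%:E)%E).
      by move=> p; apply: measurableT_comp.
    apply: filterS ae_cvg => x /gE cux _.
    have : ((u n x - u p x) ^+ 2)%:E @[p --> \oo] --> ((u n x - g x) ^+ 2)%:E.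
      apply: cvg_EFin; first exact: nearW.
      by apply: (@cvgM _ _ _ _ (fun p => u n x - u p x) (fun p => u n x - u p x));
        apply: cvgB => //; exact: cvg_cst.
    by move=> /cvg_limn_einf_sup[-> _].
  apply: le_trans (fatou _ _ _ _) _ => //.
    by move=> p x _; rewrite lee_fin sqr_ge0.
  apply: (@limn_einf_le _ _ _ n) => p np; exact: H.
exists g; split=> //.
have D2 : L2 mu (fun x => u 0%N x - g x).
  split; first exact: measurable_funB.
  by apply: le_lt_trans (Hg 0%N) _; exact: ltry.
have := L2D 1 (-1) (u2 0%N) D2; congr (L2 _ _); apply/funext => x; ring.
Qed.

End L2_complete.

(** * Order arithmetic in the extended reals *)

Lemma ge0_EFin (R : realType) (x : \bar R) :
  (0 <= x)%E -> (x < +oo)%E -> exists2 y : R, x = y%:E & 0 <= y.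
Proof. by case: x => [y| |]//; rewrite lee_fin => y0 _; exists y. Qed.

Lemma lee_cancel (R : realType) (a b c e : \bar R) : a \is a fin_num ->
  (a <= b)%E -> (b + c <= a + e)%E -> (c <= e)%E.
Proof.
move=> afin ab H; rewrite -(leeD2lE _ _ afin); apply: le_trans H.
by rewrite leeD2r.
Qed.

Lemma lee_double (R : realType) (x y : \bar R) :
  (0 <= x)%E -> (0 <= y)%E -> (x + x <= y + y)%E -> (x <= y)%E.
Proof.
case: x y => [x| |] [y| |]//=; rewrite ?leey// -?EFinD ?lee_fin => *; lra.
Qed.

(** * Existence and uniqueness of the resolvent minimizer *)

Section resolvent.
Context (d : measure_display) (T : measurableType d) (R : realType).
Variables (mu : {measure set T -> \bar R}) (E : (T -> R) -> \bar R).
Hypothesis ndfE : nonlinear_Dirichlet_form mu E.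
Implicit Types (f g h k u : T -> R) (alpha beta : R).

Lemma ndf_lty_L2 f : (E f < +oo)%E -> L2 mu f.
Proof.
by move=> H; apply: contrapT => /(ndf_outside ndfE) Ef; rewrite Ef ltxx in H.
Qed.

(** Take [f = 0] in the contraction inequality: by symmetry both sides are doubles. *)
Lemma ndf_contraction (C : R -> R) g :
  (forall a b, `|C a - C b| <= `|a - b|) -> C 0 = 0 ->
  (E (fun x => C (g x)) <= E g)%E.
Proof.
move=> C1 C0; apply: lee_double; try exact: ndf_ge0 ndfE _.
have := ndf_contr ndfE (fun=> 0) g C1 C0.
under [X in (E X + _ <= _)%E]eq_fun do rewrite add0r.
under [X in (_ + E X <= _)%E]eq_fun do rewrite add0r.
under [X in (_ <= E X + _)%E]eq_fun do rewrite add0r.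
under [X in (_ <= _ + E X)%E]eq_fun do rewrite add0r.
by rewrite (ndf_sym ndfE g) (ndf_sym ndfE (fun x => C (g x))).
Qed.

Lemma ndf_scale (t : R) g : 0 <= t <= 1 -> (E (fun x => (t * g x)%R) <= t%:E * E g)%E.
Proof.
move=> t01; have := ndf_convex ndfE g (fun=> 0) t01.
rewrite (ndf_0 ndfE) mule0 adde0.
by under [X in (E X <= _)%E]eq_fun do rewrite mulr0 addr0.
Qed.

(** The functional [J] of the overview. *)
Definition penalized alpha f g : \bar R :=
  (E g + (alpha / 2)%:E * dist2 mu g (fun x => (alpha^-1 * f x)%R))%E.

Definition mid g h (x : T) : R := 2^-1 * g x + 2^-1 * h x.

(** Contraction by the zero function around the midpoint: half the difference of [g] and [h] is
    collapsed to [0]. *)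
Lemma ndf_mid g h : (E (mid g h) + E (mid g h) <= E g + E h)%E.
Proof.
have := @ndf_contr _ _ _ _ _ ndfE (mid g h) (fun x => 2^-1 * g x - 2^-1 * h x) (fun=> 0).
rewrite subrr normr0 => /(_ (fun a b => normr_ge0 _) erefl).
under [X in (E X + _ <= _)%E]eq_fun do rewrite addr0.
under [X in (_ + E X <= _)%E]eq_fun do rewrite subr0.
rewrite (_ : (fun x => mid g h x + (2^-1 * g x - 2^-1 * h x)) = g); last first.
  by apply/funext => x; rewrite /mid; field.
rewrite (_ : (fun x => mid g h x - (2^-1 * g x - 2^-1 * h x)) = h)//.
by apply/funext => x; rewrite /mid; field.
Qed.

(** Pointwise this is the parallelogram identity. The term with [alpha / 4] is the uniform convexity
    of the penalty. *)
Lemma dist2_mid alpha g h k : 0 <= alpha ->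
  measurable_fun setT g -> measurable_fun setT h -> measurable_fun setT k ->
  (alpha%:E * dist2 mu (mid g h) k + (alpha / 4)%:E * dist2 mu g h <=
   (alpha / 2)%:E * dist2 mu g k + (alpha / 2)%:E * dist2 mu h k)%E.
Proof.
move=> a0 mg mh mk.
have mm : measurable_fun setT (mid g h).
  by apply: measurable_funD; exact: measurable_funM.
have ? : 0 <= alpha / 2 by lra.
have ? : 0 <= alpha / 4 by lra.
rewrite !scale_dist2//.
apply: ae_le_integralD; try exact: measurable_sqB;
  try by move=> x; rewrite mulr_ge0 ?sqr_ge0//; lra.
apply: aeW => x; rewrite le_eqVlt; apply/orP; left; apply/eqP.
by rewrite /mid; field.
Qed.

Lemma L2_mid g h : L2 mu g -> L2 mu h -> L2 mu (mid g h).
Proof. exact: L2D. Qed.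

(** Test the lower bound [r] at the midpoint: twice its value is at most the sum of the values at
    [g] and [h] minus [alpha / 4] times their squared distance. Positive excesses make a minimizing
    sequence Cauchy; zero excesses give uniqueness. *)
Lemma near_minimizers alpha f g h (r s t : R) : 0 < alpha ->
  L2 mu f -> L2 mu g -> L2 mu h ->
  (forall k, L2 mu k -> (r%:E <= penalized alpha f k)%E) ->
  (penalized alpha f g <= (r + s)%:E)%E ->
  (penalized alpha f h <= (r + t)%:E)%E ->
  (dist2 mu g h <= (4 / alpha * (s + t))%:E)%E.
Proof.
move=> a0 f2 g2 h2 rlb; rewrite /penalized => Jg Jh.
have := rlb _ (L2_mid g2 h2); rewrite /penalized.
have := dist2_mid (ltW a0) (proj1 g2) (proj1 h2) (proj1 (L2Z alpha^-1 f2)).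
have := ndf_mid g h; move: Jg Jh.
have E0 := ndf_ge0 ndfE.
have fin k : L2 mu k -> exists2 y, dist2 mu k (fun x => (alpha^-1 * f x)%R) = y%:E & 0 <= y.
  by move=> k2; apply: ge0_EFin; [exact: dist2_ge0|exact: dist2_fin k2 (L2Z _ f2)].
have [y -> _] := ge0_EFin (dist2_ge0 mu g h) (dist2_fin g2 h2).
have [y1 -> y10] := fin _ g2; have [y2 -> y20] := fin _ h2.
have [y3 -> y30] := fin _ (L2_mid g2 h2).
have := E0 g; have := E0 h; have := E0 (mid g h).
case: (E g) => [eg| |]//; case: (E h) => [eh| |]//; case: (E (mid g h)) => [em| |]//.
rewrite -?EFinM -?EFinD ?lee_fin => ? ? ? H1 H2 H3 H4 H5.
rewrite mulrAC ler_pdivlMr//; nra.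
Qed.

Lemma penalized_lty alpha f g : L2 mu f -> L2 mu g -> (E g < +oo)%E ->
  (penalized alpha f g < +oo)%E.
Proof.
move=> f2 g2 Eg; apply: lte_add_pinfty => //.
have [y -> _] := ge0_EFin (dist2_ge0 mu g (fun x => alpha^-1 * f x))
  (dist2_fin g2 (L2Z _ f2)).
exact: ltry.
Qed.

Lemma penalized_ge0 alpha f g : 0 < alpha -> (0 <= penalized alpha f g)%E.
Proof.
move=> a0; apply: adde_ge0; first exact: ndf_ge0 ndfE _.
by apply: mule_ge0; [rewrite lee_fin divr_ge0// ltW|exact: dist2_ge0].
Qed.

(** Young's inequality. A small [t] keeps the first coefficient near 1, at the price of a large
    weight on [dist2 mu u g]. *)
Lemma dist2_triangle (t : R) u g k : 0 < t ->
  measurable_fun setT u -> measurable_fun setT g -> measurable_fun setT k ->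
  (dist2 mu g k <= (1 + t)%:E * dist2 mu u k + (1 + t^-1)%:E * dist2 mu u g)%E.
Proof.
move=> t0 mf mg mk; rewrite -[leLHS]adde0 -[X in (_ + X)%E](integral0 mu setT).
have ti0 : 0 < t^-1 by rewrite invr_gt0.
have ? : 0 <= 1 + t by lra.
have ? : 0 <= 1 + t^-1 by lra.
rewrite -(mul1e (dist2 mu g k)) !scale_dist2//.
apply: ae_le_integralD => //; try exact: measurable_sqB;
  try by move=> x; rewrite mulr_ge0 ?sqr_ge0//; lra.
apply: aeW => x; rewrite addr0 mul1r.
have -> : g x - k x = (u x - k x) - (u x - g x) by ring.
set a := u x - k x; set b := u x - g x.
have tt : t * t^-1 = 1 by rewrite divff// gt_eqF.
have : 0 <= t^-1 * (t * a + b) ^+ 2 by rewrite mulr_ge0 ?sqr_ge0// ltW.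
have -> : t^-1 * (t * a + b) ^+ 2 = t * a ^+ 2 + 2 * a * b + t^-1 * b ^+ 2.
  by field; rewrite gt_eqF.
nra.
Qed.

(** The direct method: a minimizing sequence with geometrically small excess is fast Cauchy, and
    lower semicontinuity of [E] passes to its limit. *)
Lemma resolvent_min_exists alpha f : 0 < alpha -> L2 mu f ->
  exists g, resolvent_min mu E alpha f g.
Proof.
move=> a0 f2.
set S := [set penalized alpha f h | h in L2 mu].
have S0 : (0 <= ereal_inf S)%E.
  by apply: le_ereal_inf_tmp => _ [h _ <-]; exact: penalized_ge0.
have Sy : (ereal_inf S < +oo)%E.
  apply: (@le_lt_trans _ _ (penalized alpha f (fun=> 0))).
    by apply: ereal_inf_lbound; exists (fun=> 0) => //; exact: L2_0.
  by apply: penalized_lty => //; [exact: L2_0|rewrite (ndf_0 ndfE)].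
have [r Sr r0] := ge0_EFin S0 Sy.
have rlb h : L2 mu h -> (r%:E <= penalized alpha f h)%E.
  by move=> h2; rewrite -Sr; apply: ereal_inf_lbound; exists h.
(* The factor [alpha / 8] turns the [4 / alpha] of [near_minimizers] into [1 / 2], so two excesses
   add up to at most [16^-n]. *)
pose s n : R := alpha / 8 * 16^-1 ^+ n.
have s0 n : 0 < s n by rewrite mulr_gt0 ?exprn_gt0 ?divr_gt0// invr_gt0.
have /choice[u Hu] n : exists u, L2 mu u /\ (penalized alpha f u <= (r + s n)%:E)%E.
  have Sfin : ereal_inf S \is a fin_num by rewrite Sr.
  have [_ [u u2 <-] Hu] := lb_ereal_inf_adherent (s0 n) Sfin.
  by exists u; split=> //; rewrite EFinD -Sr ltW.
have u2 n : L2 mu (u n) by have [] := Hu n.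
have [g [g2 Hg]] : exists g, L2 mu g /\
    forall n, (dist2 mu (u n) g <= ((16^-1) ^+ n)%:E)%E.
  apply: L2_complete => // n p np.
  apply: le_trans (near_minimizers a0 f2 (u2 n) (u2 p) rlb (Hu n).2 (Hu p).2) _.
  rewrite lee_fin /s -mulrDr mulrA (_ : 4 / alpha * (alpha / 8) = 2^-1); last first.
    by field; rewrite gt_eqF.
  have : (16^-1 : R) ^+ p <= 16^-1 ^+ n by apply: ler_wiXn2l => //; lra.
  lra.
exists g; split=> // h h2; rewrite -/(penalized alpha f h); apply: le_trans (rlb h h2).
set k := fun x => alpha^-1 * f x.
have k2 : L2 mu k by exact: L2Z.
have [D DE D0] := ge0_EFin (dist2_ge0 mu g k) (dist2_fin g2 k2).
have Eg : (E g <= limn_einf (fun n => E (u n)))%E.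
  apply: (ndf_lsc ndfE) => //; apply: cvge0_squeeze (fun n => dist2_ge0 _ _ _) Hg _.
  by apply: cvg_expr; rewrite ger0_norm//; lra.
rewrite DE -EFinM.
(* A bound on [dist2 mu (u n) k] uniform in [n]: half of [alpha] times this distance is at most
   [r + s n], hence at most [r + alpha]. *)
pose K : R := (2 / alpha) * (r + alpha).
(* Young's inequality with [q = 4^-n]: the distance from [u n] to [g] is at most [q * q], so even
   divided by [q] it is of order [q], and replacing [u n] by [g] in the penalty costs a multiple of
   [q]. *)
have key n : (E (u n) <= (r - alpha / 2 * D + (alpha * (K + 3)) * 4^-1 ^+ n)%:E)%E.
  have [_] := Hu n; rewrite /penalized -/k.
  have [D' D'E D'0] := ge0_EFin (dist2_ge0 mu (u n) k) (dist2_fin (u2 n) k2).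
  have := ndf_ge0 ndfE (u n); rewrite D'E -EFinM.
  case: (E (u n)) => [e| |]//; rewrite -EFinD !lee_fin /s => e0 H1.
  set q : R := 4^-1 ^+ n.
  have q0 : 0 < q by rewrite exprn_gt0// invr_gt0.
  have q1 : q <= 1 by rewrite exprn_ile1//; lra.
  have qq1 : q * q <= 1 by rewrite mulr_ile1// ltW.
  have q2 : (16^-1 : R) ^+ n = q * q.
    by rewrite -exprMn; congr (_ ^+ n); field.
  have := dist2_triangle q0 (proj1 (u2 n)) (proj1 g2) (proj1 k2).
  have [D'' D''E D''0] := ge0_EFin (dist2_ge0 mu (u n) g) (dist2_fin (u2 n) g2).
  have := Hg n; rewrite DE D'E D''E -!EFinM -EFinD !lee_fin q2.
  rewrite q2 in H1 => H2 H3.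
  have qi : q^-1 * D'' <= q.
    by rewrite mulrC ler_pdivrMr.
  have D'K : D' <= K.
    rewrite /K mulrAC ler_pdivlMr//.
    have : alpha * (q * q) <= alpha by rewrite ler_piMr// ltW.
    nra.
  have H4 : D <= D' + (K + 2) * q by nra.
  have H5 : alpha * D <= alpha * (D' + (K + 2) * q) by rewrite ler_pM2l.
  have H6 : alpha * (q * q) <= alpha * q by rewrite ler_pM2l// ler_piMl// ltW.
  have K0 : 0 <= K by apply: le_trans D'K.
  have : 0 <= alpha * K * q := mulr_ge0 (mulr_ge0 (ltW a0) K0) (ltW q0).
  have : 0 <= alpha * q := mulr_ge0 (ltW a0) (ltW q0).
  lra.
have : (E g <= (r - alpha / 2 * D)%:E)%E.
  apply/lee_addgt0Pr => e e0; apply: (le_trans Eg).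
  have [N HN] : exists N : nat, forall n, (N <= n)%N ->
      (alpha * (K + 3)) * 4^-1 ^+ n <= e.
    by apply: expr_small => //; lra.
  apply: (@limn_einf_le _ _ _ N) => n Nn; apply: (le_trans (key n)).
  by rewrite -EFinD lee_fin lerD2l HN.
have := ndf_ge0 ndfE g; case: (E g) => [e| |]//.
rewrite -EFinD !lee_fin; lra.
Qed.

Lemma resolvent_minP alpha f : 0 < alpha -> L2 mu f ->
  resolvent_min mu E alpha f (resolvent mu E alpha f).
Proof.
by move=> a0 f2; apply: ClassicalEpsilon.epsilon_spec; exact: resolvent_min_exists.
Qed.

Lemma resolvent_min_fin alpha f g : 0 < alpha -> L2 mu f ->
  resolvent_min mu E alpha f g -> exists r, penalized alpha f g = r%:E.
Proof.
move=> a0 f2 [g2 ming].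
have [|r -> _] := @ge0_EFin R (penalized alpha f g) (penalized_ge0 f g a0); last by exists r.
apply: (le_lt_trans (ming _ (L2_0 mu))); apply: penalized_lty => //; first exact: L2_0.
by rewrite (ndf_0 ndfE).
Qed.

Lemma resolvent_min_lty alpha f g : 0 < alpha -> L2 mu f ->
  resolvent_min mu E alpha f g -> (E g < +oo)%E.
Proof.
move=> a0 f2 ming; have [r Jr] := resolvent_min_fin a0 f2 ming.
apply: (@le_lt_trans _ _ (penalized alpha f g)); last by rewrite Jr ltry.
rewrite leeDl//; apply: mule_ge0; last exact: dist2_ge0.
by rewrite lee_fin divr_ge0// ltW.
Qed.

(** The device behind the order properties: a modification of the minimizer that does not increase
    the functional agrees with it almost everywhere. *)
Lemma resolvent_min_unique alpha f g h : 0 < alpha -> L2 mu f ->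
  resolvent_min mu E alpha f g -> L2 mu h ->
  (penalized alpha f h <= penalized alpha f g)%E -> {ae mu, forall x, g x = h x}.
Proof.
move=> a0 f2 ming h2 hg; have [r Jr] := resolvent_min_fin a0 f2 ming.
have [g2 lb] := ming.
apply: dist2_eq0 => //.
have := @near_minimizers alpha f g h r 0 0 a0 f2 g2 h2.
rewrite !addr0 mulr0; apply.
- by move=> k k2; rewrite -Jr; exact: lb.
- by rewrite Jr.
- by rewrite -Jr.
Qed.

Lemma resolvent_min_congr alpha f g h : resolvent_min mu E alpha f g -> L2 mu h ->
  (penalized alpha f h <= penalized alpha f g)%E -> resolvent_min mu E alpha f h.
Proof. by move=> [g2 ming] h2 hg; split=> // k /ming; exact: le_trans hg. Qed.

End resolvent.

(** * Monotonicity, maximum principle and energy estimates for resolvents *)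

Section order.
Context (d : measure_display) (T : measurableType d) (R : realType).
Variables (mu : {measure set T -> \bar R}) (E : (T -> R) -> \bar R).
Hypothesis ndfE : nonlinear_Dirichlet_form mu E.
Implicit Types (f g h k u : T -> R) (alpha beta : R).

(** The last summand does not involve the competitor [y], so it cancels when two competitors for the
    same [z] are compared. *)
Lemma penaltyE alpha (y z : R) : 0 < alpha ->
  alpha / 2 * (y - alpha^-1 * z) ^+ 2 =
  alpha / 2 * y ^+ 2 - z * y + alpha^-1 / 2 * z ^+ 2.
Proof. by move=> a0; field; rewrite gt_eqF. Qed.

Lemma ae_le_penalty alpha f g h : 0 < alpha -> measurable_fun setT f ->
  measurable_fun setT g -> measurable_fun setT h ->
  {ae mu, forall x, (h x - alpha^-1 * f x) ^+ 2 <= (g x - alpha^-1 * f x) ^+ 2} ->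
  (dist2 mu h (fun x => (alpha^-1 * f x)%R) <= dist2 mu g (fun x => (alpha^-1 * f x)%R))%E.
Proof.
move=> a0 mf mg mh H.
have mk : measurable_fun setT (fun x => alpha^-1 * f x) by exact: measurable_funM.
apply: ae_ge0_le_integral => //.
- by move=> x _; rewrite lee_fin sqr_ge0.
- by apply/measurable_EFinP; apply: measurable_funX; exact: measurable_funB.
- by move=> x _; rewrite lee_fin sqr_ge0.
- by apply/measurable_EFinP; apply: measurable_funX; exact: measurable_funB.
by apply: filterS H => x H _; rewrite lee_fin.
Qed.

Lemma penalized_contraction alpha f g (C : R -> R) : 0 < alpha -> L2 mu f -> L2 mu g ->
  (forall a b, `|C a - C b| <= `|a - b|) -> C 0 = 0 ->
  measurable_fun setT (C \o g) ->
  {ae mu, forall x, (C (g x) - alpha^-1 * f x) ^+ 2 <= (g x - alpha^-1 * f x) ^+ 2} ->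
  L2 mu (C \o g) /\ (penalized mu E alpha f (C \o g) <= penalized mu E alpha f g)%E.
Proof.
move=> a0 f2 g2 C1 C0 mC H; split.
  apply: (L2_dom g2) => // x /=.
  by have := C1 (g x) 0; rewrite C0 !subr0.
apply: leeD; first exact: (ndf_contraction ndfE).
apply: lee_wpmul2l; first by rewrite lee_fin divr_ge0// ltW.
by apply: ae_le_penalty => //; [have [] := f2|have [] := g2].
Qed.

(** The target [alpha^-1 * f] is nonnegative, so taking absolute values moves no point away from
    it. *)
Lemma resolvent_min_abs alpha f g : 0 < alpha -> L2 mu f -> (forall x, 0 <= f x) ->
  resolvent_min mu E alpha f g -> resolvent_min mu E alpha f (Num.norm \o g).
Proof.
move=> a0 f2 f0 ming; have [g2 _] := ming.
have [] := @penalized_contraction alpha f g Num.norm a0 f2 g2.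
- exact: ler_dist_dist.
- by rewrite normr0.
- by apply: measurableT_comp => //; have [] := g2.
- apply: aeW => x; set z := alpha^-1 * f x.
  have z0 : 0 <= z by rewrite mulr_ge0// invr_ge0 ltW.
  have : 0 <= z * (`|g x| - g x) by rewrite mulr_ge0// subr_ge0 ler_norm.
  have : `|g x| ^+ 2 = g x ^+ 2 by rewrite -normrX ger0_norm ?sqr_ge0.
  nra.
- by move=> h2 H; exact: resolvent_min_congr ming h2 H.
Qed.

Lemma resolvent_min_norm_ae alpha f g : 0 < alpha -> L2 mu f -> (forall x, 0 <= f x) ->
  resolvent_min mu E alpha f g -> {ae mu, forall x, g x = `|g x|}.
Proof.
move=> a0 f2 f0 ming; have [n2 lb] := resolvent_min_abs a0 f2 f0 ming.
apply: (resolvent_min_unique ndfE a0 f2 ming n2).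
by apply: lb; have [] := ming.
Qed.

(* The lattice inequality [E (g1 \max g2) + E (g1 \min g2) <= E g1 + E g2] is the
   contraction property for [C = |.|]. *)
Lemma resolvent_min_le_ge0 alpha beta f1 f2 g1 g2 : 0 < alpha -> alpha <= beta ->
  L2 mu f1 -> L2 mu f2 -> (forall x, f2 x <= f1 x) ->
  (forall x, 0 <= g1 x) -> (forall x, 0 <= g2 x) ->
  resolvent_min mu E alpha f1 g1 -> resolvent_min mu E beta f2 g2 ->
  {ae mu, forall x, g2 x <= g1 x}.
Proof.
move=> a0 ab f1L f2L f21 g10 g20 min1 min2.
have b0 : 0 < beta by apply: lt_le_trans ab.
have [g1L lb1] := min1; have [g2L lb2] := min2.
pose s := mid g1 g2; pose e x := 2^-1 * g1 x - 2^-1 * g2 x.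
(* These are the pointwise maximum and minimum of [g1] and [g2], written as midpoint plus or minus
   half the gap to fit the contraction inequality. *)
pose M x := s x + `|e x|; pose m x := s x - `|e x|.
have me : measurable_fun setT (fun x => `|e x|).
  apply: measurableT_comp => //; have [? _] := g1L; have [? _] := g2L.
  by apply: measurable_funB; exact: measurable_funM.
have sL : L2 mu s by exact: L2_mid.
have eL : L2 mu (fun x => `|e x|).
  apply: (L2_le (c := 1) g1L g2L) => // x.
  rewrite -normrX ger0_norm ?sqr_ge0// /e.
  by have := sqr_ge0 (g1 x + g2 x); have := sqr_ge0 (g1 x); have := sqr_ge0 (g2 x); nra.
have ML : L2 mu M.
  by have := L2D 1 1 sL eL; congr (L2 _ _); apply/funext => x; rewrite !mul1r.
have mL : L2 mu m.
  by have := L2D 1 (-1) sL eL; congr (L2 _ _); apply/funext => x; rewrite mul1r mulN1r.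
have HE : (E M + E m <= E g1 + E g2)%E.
  have := ndf_contr ndfE s e (fun a b => ler_dist_dist a b) (normr0 _).
  rewrite (_ : (fun x => s x + e x) = g1); last first.
    by apply/funext => x; rewrite /s /e /mid; field.
  by rewrite (_ : (fun x => s x - e x) = g2)// ; apply/funext => x; rewrite /s /e /mid; field.
pose k1 x := alpha^-1 * f1 x; pose k2 x := beta^-1 * f2 x.
have mk1 : measurable_fun setT k1 by have [] := L2Z alpha^-1 f1L.
have mk2 : measurable_fun setT k2 by have [] := L2Z beta^-1 f2L.
have HD : ((alpha / 2)%:E * dist2 mu M k1 + (beta / 2)%:E * dist2 mu m k2 <=
    (alpha / 2)%:E * dist2 mu g1 k1 + (beta / 2)%:E * dist2 mu g2 k2)%E.
  have ? : 0 <= alpha / 2 by lra.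
  have ? : 0 <= beta / 2 by lra.
  have [? _] := g1L; have [? _] := g2L; have [? _] := ML; have [? _] := mL.
  rewrite !scale_dist2//; apply: ae_le_integralD; try exact: measurable_sqB;
    try by move=> x; rewrite mulr_ge0 ?sqr_ge0.
  apply: aeW => x; rewrite /k1 /k2 !penaltyE// /M /m /s /e /mid.
  have [e0|e0] := lerP 0 (2^-1 * g1 x - 2^-1 * g2 x).
    rewrite ger0_norm// (_ : _ + _ + (_ - _) = g1 x); last by field.
    by rewrite (_ : _ + _ - (_ - _) = g2 x); last by field.
  rewrite ltr0_norm// (_ : _ + _ + - (_ - _) = g2 x); last by field.
  rewrite (_ : _ + _ - - (_ - _) = g1 x); last by field.
  have g12 : 0 <= g2 x - g1 x by lra.
  (* Where [g1 < g2] the two values are swapped. The penalties then drop by [(f1 - f2) * (g2 - g1)]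
     plus [(beta - alpha) / 2] times the difference of squares, which is nonnegative because [g1]
     and [g2] are. *)
  have sq : 0 <= g2 x ^+ 2 - g1 x ^+ 2 by have := g10 x; have := g20 x; nra.
  have : 0 <= (f1 x - f2 x) * (g2 x - g1 x) by rewrite mulr_ge0// subr_ge0.
  have : 0 <= (beta - alpha) * (g2 x ^+ 2 - g1 x ^+ 2) by rewrite mulr_ge0// subr_ge0.
  nra.
have [r1 J1] := resolvent_min_fin ndfE a0 f1L min1.
have H2 : (penalized mu E beta f2 m <= penalized mu E beta f2 g2)%E.
  (* Minimality of [g1] against [M] cancels the [alpha] terms from the joint inequality. What
     remains makes [m] a minimizer for [beta], so [g2] equals the minimum almost everywhere. *)
  apply: (@lee_cancel _ (penalized mu E alpha f1 g1) (penalized mu E alpha f1 M)).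
  - by rewrite J1.
  - exact: lb1.
  - by rewrite /penalized addeACA [leRHS]addeACA; exact: leeD.
apply: filterS (resolvent_min_unique ndfE b0 f2L min2 mL H2) => x ->.
rewrite /m /s /mid /e; have := ler_norm (- (2^-1 * g1 x - 2^-1 * g2 x)); rewrite normrN; lra.
Qed.

(** The chosen minimizers are nonnegative only almost everywhere, so the comparison is made for
    their absolute values and then transferred back. *)
Lemma resolvent_le alpha beta f1 f2 : 0 < alpha -> alpha <= beta ->
  L2 mu f1 -> L2 mu f2 -> (forall x, 0 <= f2 x <= f1 x) ->
  {ae mu, forall x, 0 <= resolvent mu E beta f2 x <= resolvent mu E alpha f1 x}.
Proof.
move=> a0 ab f1L f2L f12.
have b0 : 0 < beta by apply: lt_le_trans ab.
have f20 x : 0 <= f2 x by have /andP[] := f12 x.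
have f21 x : f2 x <= f1 x by have /andP[] := f12 x.
have f10 x : 0 <= f1 x by have /andP[] := f12 x; exact: le_trans.
have min1 := resolvent_minP ndfE a0 f1L.
have min2 := resolvent_minP ndfE b0 f2L.
have N1 := resolvent_min_norm_ae a0 f1L f10 min1.
have N2 := resolvent_min_norm_ae b0 f2L f20 min2.
have H := resolvent_min_le_ge0 a0 ab f1L f2L f21
  (fun x => normr_ge0 _) (fun x => normr_ge0 _)
  (resolvent_min_abs a0 f1L f10 min1) (resolvent_min_abs b0 f2L f20 min2).
near=> x; have -> : resolvent mu E beta f2 x = `|resolvent mu E beta f2 x| by near: x.
have -> : resolvent mu E alpha f1 x = `|resolvent mu E alpha f1 x| by near: x.
by rewrite normr_ge0/=; near: x.
Unshelve. all: by end_near.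
Qed.

(* The contraction [y |-> N/2 - |y - N/2|] applied to [g/2] shows that [E] is
   superadditive on the decomposition [g = g \min N + (g - N)^+]. *)
Lemma resolvent_min_trunc alpha f g (N : R) : 0 < alpha -> L2 mu f -> 0 <= N ->
  (forall x, 0 <= f x) -> (forall x, 0 <= g x) -> resolvent_min mu E alpha f g ->
  (E (fun x => Num.min (g x) N) <= N%:E * \int[mu]_x (f x)%:E)%E.
Proof.
move=> a0 f2 N0 f0 g0 ming; have [g2 lb] := ming.
pose C y : R := N / 2 - `|y - N / 2|.
have C1 a b : `|C a - C b| <= `|a - b|.
  rewrite (_ : C a - C b = `|b - N / 2| - `|a - N / 2|); last by rewrite /C; ring.
  rewrite [leRHS]distrC; apply: (le_trans (ler_dist_dist _ _)).
  by rewrite (_ : b - N / 2 - (a - N / 2) = b - a)//; ring.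
have C0 : C 0 = 0 by rewrite /C sub0r normrN ger0_norm ?subrr// divr_ge0.
pose h x := g x - Num.min (g x) N.
have HE : (E (fun x => Num.min (g x) N) + E h <= E g)%E.
  have := ndf_contr ndfE (fun x => 2^-1 * g x) (fun x => 2^-1 * g x) C1 C0.
  rewrite (_ : (fun x => 2^-1 * g x + C (2^-1 * g x)) = fun x => Num.min (g x) N); last first.
    apply/funext => x; rewrite /C; have [gN|gN] := leP (g x) N.
      by rewrite ler0_norm; [field|lra].
    by rewrite gtr0_norm; [field|lra].
  rewrite (_ : (fun x => 2^-1 * g x - C (2^-1 * g x)) = h); last first.
    apply/funext => x; rewrite /C /h; have [gN|gN] := leP (g x) N.
      by rewrite ler0_norm; [field|lra].
    by rewrite gtr0_norm; [field|lra].
  rewrite (_ : (fun x => 2^-1 * g x + 2^-1 * g x) = g); last by apply/funext => x; field.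
  rewrite (_ : (fun x => 2^-1 * g x - 2^-1 * g x) = fun=> 0); last first.
    by apply/funext => x; rewrite subrr.
  by rewrite (ndf_0 ndfE) adde0.
have [mg _] := g2; have [mf _] := f2.
have mh : measurable_fun setT h by apply: measurable_funB => //; exact: measurable_minr.
have h0 x : 0 <= h x by rewrite subr_ge0 ge_min lexx.
have hg x : h x <= g x by rewrite gerBl le_min g0 N0.
have hL : L2 mu h.
  by apply: (L2_dom g2) => // x; rewrite !ger0_norm.
have mk : measurable_fun setT (fun x => alpha^-1 * f x) by exact: measurable_funM.
(* Passing from [g] to [h] lowers the quadratic part, and the linear part changes by the integral of
   [f * Num.min g N], at most [N] times that of [f]. *)
have HD : ((alpha / 2)%:E * dist2 mu h (fun x => (alpha^-1 * f x)%R) <=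
    (alpha / 2)%:E * dist2 mu g (fun x => (alpha^-1 * f x)%R) + N%:E * \int[mu]_x (f x)%:E)%E.
  have ? : 0 <= alpha / 2 by lra.
  rewrite !scale_dist2// -ge0_integralZl_EFin//; last 2 first.
    by move=> x _; rewrite lee_fin.
    exact/measurable_EFinP.
  rewrite -[leLHS]adde0 -[X in (_ + X)%E](integral0 mu setT).
  apply: ae_le_integralD => //; try exact: measurable_sqB;
    try by move=> x; rewrite mulr_ge0 ?sqr_ge0.
    by apply: measurable_funM.
  apply: aeW => x; rewrite !penaltyE// addr0.
  have sq : 0 <= g x ^+ 2 - h x ^+ 2 by have := h0 x; have := hg x; nra.
  have : 0 <= alpha * (g x ^+ 2 - h x ^+ 2) by rewrite mulr_ge0// ltW.
  have : f x * (g x - h x) <= f x * N.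
    by rewrite ler_wpM2l// /h opprB addrC subrK ge_min lexx orbT.
  nra.
have Egy := resolvent_min_lty ndfE a0 f2 ming.
have Ehfin : E h \is a fin_num.
  rewrite ge0_fin_numE; last exact: ndf_ge0 ndfE _.
  apply: le_lt_trans Egy; apply: le_trans HE.
  by rewrite leeDr//; exact: ndf_ge0 ndfE _.
have := lb h hL.
set D := (_ * dist2 mu g _)%E in HD *.
have Dfin : D \is a fin_num.
  apply: fin_numM => //; rewrite ge0_fin_numE ?dist2_ge0//.
  by apply: dist2_fin => //; exact: L2Z.
move=> H; rewrite -(leeD2lE _ _ Ehfin) -(leeD2rE _ _ Dfin).
apply: (@le_trans _ _ (E g + D)%E).
  by rewrite leeD2r// addeC.
by apply: (le_trans H); rewrite -addeA leeD2l// addeC.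
Qed.

(** Truncating at [m] changes nothing on [A]. Off [A] the target is [0], and truncation only moves
    [g] towards it. *)
Lemma resolvent_min_ub alpha f g (A : set T) (m : R) : 0 < alpha -> L2 mu f -> 0 <= m ->
  (forall x, ~ A x -> f x = 0) -> resolvent_min mu E alpha f g ->
  {ae mu, forall x, A x -> g x <= m} -> {ae mu, forall x, g x <= m}.
Proof.
move=> a0 f2 m0 fA ming gm; have [g2 lb] := ming.
have [||||hL H] := @penalized_contraction alpha f g (Num.min^~ m) a0 f2 g2.
- move=> a b /=; have [? | ?] := leP a m; have [? | ?] := leP b m => //.
  + by rewrite ler_norml; apply/andP; split; have := ler_norm (a - b);
      have := ler_norm (b - a); rewrite distrC; lra.
  + by rewrite ler_norml; apply/andP; split; have := ler_norm (a - b);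
      have := ler_norm (b - a); rewrite distrC; lra.
  + by rewrite subrr normr0.
- by rewrite /=; apply/min_idPl.
- by apply: measurable_minr => //; have [] := g2.
- apply: filterS gm => x gm /=.
  have [/gm gmx|/fA ->] := pselect (A x).
    by rewrite (min_idPl gmx).
  rewrite mulr0 !subr0; have [//|mg] := leP (g x) m.
  nra.
apply: filterS (resolvent_min_unique ndfE a0 f2 ming hL H) => x ->.
by rewrite /= ge_min lexx orbT.
Qed.

(** Compare [g] with the competitor [h]. The linear term in [g] is controlled by [g <= m]; on the
    right only the quadratic term in [h] carries [alpha], so it disappears as [alpha] tends to [0]
    for a fixed [m]. *)
Lemma resolvent_min_test alpha f g h (m : R) : 0 < alpha -> L2 mu f -> 0 <= m ->
  (forall x, 0 <= f x) -> resolvent_min mu E alpha f g ->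
  {ae mu, forall x, g x <= m} -> L2 mu h -> (forall x, 0 <= h x) ->
  (\int[mu]_x (f x * h x)%:E <=
   E h + ((alpha / 2)%:E * \int[mu]_x (h x ^+ 2)%:E + m%:E * \int[mu]_x (f x)%:E))%E.
Proof.
move=> a0 f2 m0 f0 ming gm hL h0; have [g2 lb] := ming.
have [mg _] := g2; have [mf _] := f2; have [mh _] := hL.
set k := fun x => alpha^-1 * f x.
have kL : L2 mu k by exact: L2Z.
have mk : measurable_fun setT k by have [] := kL.
have ? : 0 <= alpha / 2 by lra.
have mh2 : measurable_fun setT (fun x => alpha / 2 * h x ^+ 2).
  by apply: measurable_funM => //; exact: measurable_funX.
have mmf : measurable_fun setT (fun x => m * f x) by exact: measurable_funM.
have H : (\int[mu]_x (f x * h x)%:E + (alpha / 2)%:E * dist2 mu h k <=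
    \int[mu]_x (alpha / 2 * h x ^+ 2 + m * f x)%:E + (alpha / 2)%:E * dist2 mu g k)%E.
  rewrite !scale_dist2//; apply: ae_le_integralD; try exact: measurable_sqB;
    try by move=> x; rewrite mulr_ge0 ?sqr_ge0.
  - exact: measurable_funM.
  - exact: measurable_funD.
  - by move=> x; rewrite addr_ge0// mulr_ge0// sqr_ge0.
  apply: filterS gm => x gm; rewrite /k !penaltyE//.
  have : 0 <= f x * (m - g x) by rewrite mulr_ge0// subr_ge0.
  have : 0 <= alpha / 2 * g x ^+ 2 by rewrite mulr_ge0 ?sqr_ge0.
  nra.
have -> : ((alpha / 2)%:E * \int[mu]_x (h x ^+ 2)%:E + m%:E * \int[mu]_x (f x)%:E =
    \int[mu]_x (alpha / 2 * h x ^+ 2 + m * f x)%:E)%E.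
  rewrite -!ge0_integralZl_EFin//; try (by move=> x _; rewrite lee_fin ?sqr_ge0);
    try exact/measurable_EFinP; last by apply/measurable_EFinP; exact: measurable_funX.
  rewrite -ge0_integralD//.
  - by move=> x _; rewrite lee_fin mulr_ge0 ?sqr_ge0.
  - exact/measurable_EFinP.
  - by move=> x _; rewrite lee_fin mulr_ge0.
  - exact/measurable_EFinP.
set D := (_ * dist2 mu h _)%E in H *.
have Dfin : D \is a fin_num.
  by apply: fin_numM => //; rewrite ge0_fin_numE ?dist2_ge0//; exact: dist2_fin.
rewrite -(leeD2rE _ _ Dfin); apply: (le_trans H).
rewrite addeC addeAC leeD2r//; apply: le_trans (lb h hL).
by rewrite leeDr//; exact: ndf_ge0 ndfE _.
Qed.

End order.

(** * Measures of sets, scaled indicators and exhaustions *)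

Section measure_facts.
Context (d : measure_display) (T : measurableType d) (R : realType).
Variable mu : {measure set T -> \bar R}.

Lemma cvge0_eps (v : nat -> \bar R) : (forall n, (0 <= v n)%E) ->
  (forall e : R, 0 < e -> exists N : nat, forall n, (N <= n)%N -> (v n <= e%:E)%E) ->
  v @ \oo --> 0%E.
Proof.
move=> v0 H; apply/fine_cvgP; split.
  have [N HN] := H 1 ltr01; exists N => // n /= Nn.
  by rewrite ge0_fin_numE//; apply: le_lt_trans (HN n Nn) _; exact: ltry.
apply/cvgrPdist_le => e e0; have [N HN] := H e e0; exists N => // n /= Nn.
rewrite sub0r normrN ger0_norm ?fine_ge0//.
rewrite -lee_fin fineK ?HN// ge0_fin_numE//.
by apply: le_lt_trans (HN n Nn) _; exact: ltry.
Qed.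

Lemma limn_esup_lt (v : nat -> \bar R) : (limn_esup v < +oo)%E ->
  exists (N : nat) (M : R), forall n, (N <= n)%N -> (v n <= M%:E)%E.
Proof.
move=> H; have [M HM] : exists M : R, (limn_esup v < M%:E)%E.
  case: (limn_esup v) H => [r| |]// _; last by exists 0; rewrite ltNyr.
  by exists (r + 1); rewrite lte_fin ltrDl.
move: HM; rewrite /limn_esup limf_esupE => /ereal_inf_lt[_ [V [N _ NV] <-] HM].
exists N, M => n Nn; apply: le_trans (ltW HM).
by apply: ereal_sup_ubound; exists n => //; exact: NV.
Qed.

Lemma le_measureU2 (A B C : set T) : measurable A -> measurable B -> measurable C ->
  C `<=` A `|` B -> (mu C <= mu A + mu B)%E.
Proof.
move=> mA mB mC CAB; rewrite (measureDI mu mC mA) addeC.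
apply: leeD; apply: le_measure; rewrite ?inE//.
- exact: measurableI.
- exact: measurableD.
- by move=> x [/CAB[]].
Qed.

Lemma integral_scale_indic (A : set T) (c : R) : measurable A -> 0 <= c ->
  (\int[mu]_x (c * \1_A x)%:E = c%:E * mu A)%E.
Proof.
move=> mA c0; under eq_integral do rewrite EFinM.
rewrite ge0_integralZl_EFin//; last by apply/measurable_EFinP; exact: measurable_indic.
by rewrite integral_indic// setIT.
Qed.

Lemma measurable_scale_indic (A : set T) (c : R) : measurable A ->
  measurable_fun setT (fun x => c * \1_A x).
Proof. by move=> mA; apply: measurable_funM => //; exact: measurable_indic. Qed.

Lemma L2_scale_indic (A : set T) (c : R) : measurable A -> (mu A < +oo)%E ->
  L2 mu (fun x => c * \1_A x).
Proof.
move=> mA Afin; split; first exact: measurable_scale_indic.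
under eq_integral => x _.
  rewrite (_ : (c * \1_A x) ^+ 2 = c ^+ 2 * \1_A x); last first.
    by rewrite indicE; case: (_ \in _); rewrite ?mulr1 ?mulr0 ?expr0n.
  over.
by rewrite integral_scale_indic ?sqr_ge0// lte_mul_pinfty// lee_fin sqr_ge0.
Qed.

Lemma sigma_finite_nondecreasing : sigma_finite setT mu ->
  exists A : nat -> set T, [/\ forall n, measurable (A n), forall n, (mu (A n) < +oo)%E,
    nondecreasing_seq A & \bigcup_n A n = setT].
Proof.
move=> [F FT HF]; exists (fun n => \big[setU/set0]_(i < n) F i); split.
- by move=> n; apply: bigsetU_measurable => i _; have [] := HF i.
- elim=> [|n IH]; first by rewrite big_ord0 measure0.
  rewrite big_ord_recr /=.
  have mB : measurable (\big[setU/set0]_(i < n) F i).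
    by apply: bigsetU_measurable => i _; have [] := HF i.
  have [mFn Fn] := HF n.
  have mU : measurable (\big[setU/set0]_(i < n) F i `|` F n) by exact: measurableU.
  apply: le_lt_trans (le_measureU2 mB mFn mU (fun=> id)) _.
  exact: lte_add_pinfty.
- by move=> m n mn; apply/subsetPset; exact: subset_bigsetU.
- apply/seteqP; split=> // x; rewrite FT => -[i _ Fx].
  by exists i.+1 => //; rewrite big_ord_recr /=; right.
Qed.

End measure_facts.

(** * Criticality and the existence of cutoffs *)

Section cutoffs.
Context (d : measure_display) (T : measurableType d) (R : realType).
Variables (mu : {measure set T -> \bar R}) (E : (T -> R) -> \bar R).

(** A single [eps] bounds the energy, the deviation from 1 and the measure of the exceptional set.
    Each [A] is treated separately; an exhaustion later merges them into one sequence. *)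
Definition cutoffs : Prop := forall (lam eps : R) (A : set T),
  0 < lam -> 0 < eps -> measurable A -> (mu A < +oo)%E ->
  exists v : T -> R, [/\ measurable_fun setT v, forall x, 0 <= v x <= 1,
    (E (fun x => (lam * v x)%R) <= eps%:E)%E &
    (mu (A `&` [set x | (eps < `|v x - 1|)%R]) <= eps%:E)%E].

Hypothesis ndfE : nonlinear_Dirichlet_form mu E.

(** From [n = 1] on the truncations leave [f] unchanged, so the upper limit is that of an eventually
    constant sequence. *)
Lemma resolvent_pos_le1 (alpha : R) (f : T -> R) : (forall x, f x <= 1) ->
  resolvent_pos mu E alpha f = fun x => (resolvent mu E alpha f x)%:E.
Proof.
move=> f1; apply/funext => x; rewrite /resolvent_pos.
have H n : (1 <= n)%N ->
    (resolvent mu E alpha (fun y => Num.min (f y) n%:R) x)%:E = (resolvent mu E alpha f x)%:E.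
  move=> n1; congr ((resolvent _ _ _ _ x)%:E); apply/funext => y; apply/min_idPl.
  by apply: (le_trans (f1 y)); rewrite ler1n.
apply/eqP; rewrite eq_le; apply/andP; split.
  by apply: (@limn_esup_le _ _ _ 1%N) => n /H ->.
by apply: (@limn_esup_ge _ _ _ 1%N) => n /H ->.
Qed.

Lemma critical_cutoffs : critical mu E -> cutoffs.
Proof.
move=> crit lam eps A lam0 eps0 mA Afin.
have [a aE a0] := ge0_EFin (measure_ge0 mu A) Afin.
(* The bound 1 makes [resolvent_pos] the plain resolvent. The other bound makes the energy estimate
   [lam * (c * a)] at most [eps], with [a + 1] preventing division by zero. *)
pose c := Num.min 1 (eps / (lam * (a + 1))).
have la0 : 0 < lam * (a + 1) by rewrite mulr_gt0// ltr_wpDl.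
have c0 : 0 < c by rewrite lt_min ltr01 divr_gt0.
have c1 : c <= 1 by rewrite ge_min lexx.
have ca : lam * (c * a) <= eps.
  have : c * (lam * (a + 1)) <= eps.
    by rewrite -ler_pdivlMr// ge_min lexx orbT.
  have := mulr_ge0 (ltW lam0) (ltW c0); nra.
pose f x := c * \1_A x.
have f0 x : 0 <= f x by rewrite mulr_ge0// ltW.
have f1 x : f x <= 1.
  by rewrite /f indicE; case: (_ \in _); rewrite ?mulr1 ?mulr0.
have mf : measurable_fun setT f by exact: measurable_scale_indic.
have f2 : L2 mu f by exact: L2_scale_indic.
have If : (\int[mu]_x (f x)%:E = (c * a)%:E)%E.
  by rewrite integral_scale_indic ?(ltW c0)// aE.
pose al k : R := k.+1%:R^-1.
have al0 k : 0 < al k by rewrite invr_gt0.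
pose r k := resolvent mu E (al k) f; pose g k := Num.norm \o r k.
have minr k : resolvent_min mu E (al k) f (r k) by exact: resolvent_minP.
have ming k : resolvent_min mu E (al k) f (g k) by exact: resolvent_min_abs.
have mr k : measurable_fun setT (r k) by have [[]] := minr k.
have mg k : measurable_fun setT (g k) by exact: measurableT_comp.
have greenE : green mu E f = fun x => limn_esup (fun k => (r k x)%:E).
  by apply/funext => x; rewrite /green; congr limn_esup; apply/funext => k;
    rewrite resolvent_pos_le1.
pose B := [set x | 0 < f x] `&` [set x | (green mu E f x < +oo)%E].
have mB : measurable B.
  apply: measurableI.
    by rewrite -[X in measurable X]setTI -preimage_itvoy; exact: mf.
  rewrite -[X in measurable X]setTI; apply: emeasurable_fun_infty_o => //.
  by rewrite greenE; apply: measurable_fun_limn_esup => k; exact/measurable_EFinP.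
have B0 : mu B = 0%E.
  apply: crit => //; apply/integrableP; split; first exact/measurable_EFinP.
  by under eq_integral do rewrite gee0_abs ?lee_fin//; rewrite If ltry.
(* Requiring all [j <= k] makes [D] decreasing at every point, so continuity from above applies. On
   the whole intersection the Green function is at most [lam], hence it lies in the null set [B]. *)
pose D k := \bigcap_(j in [set j | (j <= k)%N]) (A `&` [set x | g j x < lam]).
have mA' j : measurable (A `&` [set x | g j x < lam]).
  apply: measurableI => //; rewrite -[X in measurable X]setTI -preimage_itvNyo; exact: mg.
have mD k : measurable (D k) by apply: bigcap_measurableType => j _.
have mDD : measurable (\bigcap_k D k) by exact: bigcapT_measurable.
have D0 : mu (\bigcap_k D k) = 0%E.
  apply/eqP; rewrite -measure_le0 -B0; apply: le_measure; rewrite ?inE// => x Dx.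
  have Dj j : A x /\ g j x < lam by exact: (Dx j I j (leqnn j)).
  split=> /=; first by rewrite /f indicE mem_set ?mulr1//; have [] := Dj 0%N.
  rewrite greenE; apply: (@le_lt_trans _ _ lam%:E); last exact: ltry.
  apply: (@limn_esup_le _ _ _ 0%N) => k _; rewrite lee_fin.
  by apply: le_trans (ler_norm _) _; apply: ltW; have [] := Dj k.
have [k Dk] : exists k, (mu (D k) < eps%:E)%E.
  have := @nonincreasing_cvg_mu _ _ _ mu D.
  rewrite D0 => /(_ _ mD mDD _) cvgD.
  have [||N HN] := @cvge0_small _ (mu \o D) eps (cvgD _ _) eps0; last by exists N; exact: HN.
  - apply: le_lt_trans Afin; apply: le_measure; rewrite ?inE//.
    by move=> x /(_ 0%N (leqnn _))[].
  - by move=> m n mn; apply/subsetPset => x Dx j jm; apply: Dx; exact: leq_trans jm mn.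
(* Up to a null set, [g k x < lam] now implies the same for all earlier indices, so the points of
   [A] outside [D k] satisfy [lam <= g k x], where the cutoff equals 1. *)
have mono : {ae mu, forall x, forall j, (j <= k)%N -> g j x <= g k x}.
  apply: ae_foralln => j; have [jk|jk] := boolP (j <= k)%N; last by apply: aeW.
  have : al k <= al j by rewrite lef_pV2 ?posrE ?ltr0n// ler_nat ltnS.
  move=> aa; apply: filterS (resolvent_min_le_ge0 ndfE (al0 k) aa f2 f2 (fun=> lexx _)
    (fun x => normr_ge0 _) (fun x => normr_ge0 _) (ming k) (ming j)) => x H _.
  exact: H.
exists (fun x => lam^-1 * Num.min (g k x) lam); split.
- by apply: measurable_funM => //; exact: measurable_minr.
- move=> x; rewrite mulr_ge0 ?invr_ge0 ?(ltW lam0)//=; last first.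
    by rewrite le_min normr_ge0 ltW.
  by rewrite mulrC ler_pdivrMr// mul1r ge_min lexx orbT.
- rewrite (_ : (fun x => _) = fun x => Num.min (g k x) lam); last first.
    by apply/funext => x; rewrite mulrA divff ?mul1r// gt_eqF.
  apply: le_trans (resolvent_min_trunc ndfE (al0 k) f2 (ltW lam0) f0 _ (ming k)) _.
    by move=> x; exact: normr_ge0.
  by rewrite If -EFinM lee_fin.
- have [N [mN N0 sN]] := mono.
  apply: (@le_trans _ _ (mu (D k) + mu N)%E); last by rewrite N0 adde0 ltW.
  apply: le_measureU2 => //.
    apply: measurableI => //; rewrite -[X in measurable X]setTI -preimage_itvoy.
    apply: measurableT_comp => //; apply: measurable_funB => //.
    by apply: measurable_funM => //; exact: measurable_minr.
  move=> x [Ax /= ev]; have [xN|xN] := pselect (N x); [by right|left].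
  have gk : g k x < lam.
    rewrite ltNge; apply/negP => lg; move: ev.
    by rewrite (min_idPr lg) mulVf ?gt_eqF// subrr normr0 ltNge (ltW eps0).
  have M : forall j, (j <= k)%N -> g j x <= g k x.
    by apply: contrapT => nM; apply: xN; exact: sN.
  by move=> j /= jk; split=> //=; apply: le_lt_trans (M j jk) gk.
Qed.

(** The function [c * \1_A] lies below [f], so its resolvents are at most [m] on [A], hence
    everywhere by the maximum principle. If [A] had positive measure, testing with a large multiple
    of a cutoff would give a contradiction. *)
Lemma cutoffs_null (f : T -> R) (m : nat) (A : set T) : cutoffs ->
  L2 mu f -> (forall x, 0 <= f x) -> measurable A -> (mu A < +oo)%E ->
  (forall x, A x -> m.+1%:R^-1 <= f x) ->
  (forall x k, A x -> (m <= k)%N -> resolvent mu E k.+1%:R^-1 f x <= m%:R) ->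
  mu A = 0%E.
Proof.
move=> Q f2 f0 mA Afin Af Ar.
have [a aE] := ge0_EFin (measure_ge0 mu A) Afin.
rewrite le_eqVlt => /orP[/eqP a0|a0]; first by rewrite aE -a0.
exfalso.
pose c : R := m.+1%:R^-1; have c0 : 0 < c by rewrite invr_gt0.
(* Chosen so that [(1 - eps) * a - eps >= a / 4], which bounds the integral of the cutoff over [A]
   from below. *)
pose eps : R := Num.min 2^-1 (a / 4).
have eps0 : 0 < eps by rewrite lt_min invr_gt0 ltr0n divr_gt0.
have eps1 : eps <= 2^-1 by rewrite ge_min lexx.
have eps2 : eps <= a / 4 by rewrite ge_min lexx orbT.
have ca0 : 0 < c * a by rewrite mulr_gt0.
(* Then [lam * c * (a / 4) = 1 + m * (c * a)], which exceeds the upper bound [eps + m * (c * a)]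
   since [eps <= 1 / 2]. *)
pose lam := 4 * (1 + m%:R * (c * a)) / (c * a).
have lam0 : 0 < lam by rewrite divr_gt0// mulr_gt0// ltr_pwDl// mulr_ge0// ltW.
have [v [mv v01 Ev Av]] := Q lam eps A lam0 eps0 mA Afin.
have v0 x : 0 <= v x by have /andP[] := v01 x.
pose h x := lam * v x.
have h0 x : 0 <= h x by rewrite mulr_ge0// ltW.
have hL : L2 mu h by apply: (ndf_lty_L2 ndfE); apply: le_lt_trans Ev _; exact: ltry.
pose f' x := c * \1_A x.
have f'0 x : 0 <= f' x by rewrite mulr_ge0// ltW.
have f'2 : L2 mu f' by exact: L2_scale_indic.
have f'f x : f' x <= f x.
  rewrite /f' indicE; have [/set_mem/Af|_] := boolP (x \in A); first by rewrite mulr1.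
  by rewrite mulr0.
have If' : (\int[mu]_x (f' x)%:E = (c * a)%:E)%E.
  by rewrite integral_scale_indic ?(ltW c0)// aE.
have h20 : (0 <= \int[mu]_x (h x ^+ 2)%:E)%E.
  by apply: integral_ge0 => x _; rewrite lee_fin sqr_ge0.
have [H2 H2E H20] := ge0_EFin h20 (proj2 hL).
have test k : (m <= k)%N -> (\int[mu]_x (f' x * h x)%:E <=
    (eps + (k.+1%:R^-1 / 2 * H2 + m%:R * (c * a)))%:E)%E.
  move=> mk; have al0 : 0 < k.+1%:R^-1 :> R by rewrite invr_gt0.
  have min' := resolvent_minP ndfE al0 f'2.
  have ub : {ae mu, forall x, resolvent mu E k.+1%:R^-1 f' x <= m%:R}.
    apply: (resolvent_min_ub ndfE al0 f'2 (ler0n _ _) _ min' (A := A)).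
      by move=> x nAx; rewrite /f' indicE memNset ?mulr0.
    have H x : 0 <= f' x <= f x by rewrite f'0 f'f.
    apply: filterS (resolvent_le ndfE al0 (lexx _) f2 f'2 H) => x /andP[_ +] Ax.
    by move=> /le_trans; apply; exact: Ar.
  have := resolvent_min_test ndfE al0 f'2 (ler0n _ _) f'0 min' ub hL h0.
  rewrite If' H2E; move/le_trans; apply.
  by rewrite !EFinD; apply: leeD => //; rewrite -EFinM.
(* Here [alpha = 1 / (k + 1)] tends to 0, which removes the term with [H2]. *)
have test' : (\int[mu]_x (f' x * h x)%:E <= (eps + m%:R * (c * a))%:E)%E.
  apply/lee_addgt0Pr => e e0.
  have [N HN] : exists N, forall n, (N <= n)%N -> n.+1%:R^-1 <= (e / (H2 + 1) : R).
    have eH : 0 < e / (H2 + 1) by rewrite divr_gt0// ltr_wpDl.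
    have /cvgrPdist_le/(_ _ eH)[N _ HN] := @cvg_harmonic R.
    by exists N => n /HN; rewrite sub0r normrN /= ger0_norm// invr_ge0.
  apply: le_trans (test (maxn m N) (leq_maxl _ _)) _; rewrite -EFinD lee_fin.
  have := HN (maxn m N) (leq_maxr _ _); set t := _^-1.
  rewrite ler_pdivlMr; last by rewrite ltr_wpDl.
  have t0 : 0 <= t by rewrite invr_ge0.
  nra.
pose S := A `&` [set x | eps < `|v x - 1|].
have mS : measurable S.
  apply: measurableI => //; rewrite -[X in measurable X]setTI -preimage_itvoy.
  by apply: measurableT_comp => //; exact: measurable_funB.
have clam0 : 0 <= c * lam by rewrite mulr_ge0// ltW.
(* On [A] either [v >= 1 - eps], or the point lies in [S], where the additional indicator
   compensates. *)
have H : (\int[mu]_x (c * lam * (1 - eps) * \1_A x)%:E + \int[mu]_x (0 : R)%:E <=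
    \int[mu]_x (f' x * h x)%:E + \int[mu]_x (c * lam * \1_S x)%:E)%E.
  have ce0 : 0 <= c * lam * (1 - eps) by rewrite mulr_ge0//; lra.
  apply: ae_le_integralD => //; try exact: measurable_scale_indic;
    try by move=> x; rewrite mulr_ge0.
    by apply: measurable_funM; [have [] := f'2|have [] := hL].
  apply: aeW => x; rewrite addr0 /f' /h !indicE.
  have [/set_mem Ax|nAx] := boolP (x \in A); last first.
    rewrite !mulr0 mul0r add0r mulr_ge0//.
  rewrite !mulr1; have [_|nS] := boolP (x \in S).
    rewrite mulr1; have := mulr_ge0 clam0 (v0 x); have := mulr_ge0 clam0 (ltW eps0); nra.
  have : 1 - eps <= v x.
    have /negP : ~ (eps < `|v x - 1|).
      by move=> K; move/negP: nS; apply; apply/mem_set; split.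
    rewrite -leNgt ler_distl => /andP[]; lra.
  by move=> /(ler_wpM2l clam0); rewrite mulr0 addr0; nra.
move: H; rewrite integral0 adde0 !integral_scale_indic//; last first.
  by rewrite mulr_ge0//; lra.
rewrite aE -EFinM => /le_trans/(_ (leeD test' (lee_wpmul2l _ Av))).
rewrite lee_fin => /(_ clam0); rewrite -EFinM -EFinD lee_fin.
have laE : lam * (c * a) = 4 * (1 + m%:R * (c * a)).
  by rewrite /lam mulfVK// gt_eqF.
have : c * lam * (a / 4) <= c * lam * ((1 - eps) * a - eps).
  by apply: ler_wpM2l => //; nra.
nra.
Qed.

(** The square of the truncation is at most [n * f]. *)
Lemma L2_min (f : T -> R) (n : nat) : measurable_fun setT f -> (forall x, 0 <= f x) ->
  mu.-integrable setT (fun x => (f x)%:E) -> L2 mu (fun x => Num.min (f x) n%:R).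
Proof.
move=> mf f0 /integrableP[_ If]; have mm : measurable_fun setT (fun x => Num.min (f x) n%:R).
  exact: measurable_minr.
split=> //; apply: (@le_lt_trans _ _ (n%:R%:E * \int[mu]_x `|(f x)%:E|)%E); last first.
  by rewrite lte_mul_pinfty.
rewrite -ge0_integralZl_EFin//; last by apply: measurableT_comp => //; exact/measurable_EFinP.
apply: ge0_le_integral => //.
- by move=> x _; rewrite lee_fin sqr_ge0.
- by apply/measurable_EFinP; exact: measurable_funX.
- apply: emeasurable_funM => //.
  by apply: measurableT_comp => //; exact/measurable_EFinP.
move=> x _; rewrite gee0_abs; last by rewrite lee_fin.
rewrite -EFinM lee_fin expr2.
by apply: ler_pM; rewrite ?le_min ?f0 ?ler0n// ge_min lexx ?orbT.
Qed.

Lemma cutoffs_critical : cutoffs -> critical mu E.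
Proof.
move=> Q f mf f0 If.
pose al k : R := k.+1%:R^-1.
have al0 k : 0 < al k by rewrite invr_gt0.
pose fn n x := Num.min (f x) n%:R.
have fnL n : L2 mu (fn n) by exact: L2_min.
have fn0 n x : 0 <= fn n x by rewrite le_min f0 ler0n.
pose r k n := resolvent mu E (al k) (fn n).
have mr k n : measurable_fun setT (r k n).
  by have [[]] := resolvent_minP ndfE (al0 k) (fnL n).
have mgreen : measurable_fun setT (green mu E f).
  apply: measurable_fun_limn_esup => k; apply: measurable_fun_limn_esup => n.
  exact/measurable_EFinP/mr.
apply/negligibleP.
  apply: measurableI.
    by rewrite -[X in measurable X]setTI -preimage_itvoy; exact: mf.
  by rewrite -[X in measurable X]setTI; apply: emeasurable_fun_infty_o.
(* The truncation at level 1 is enough: its resolvents lie below those of all later truncations, so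
   they stay bounded wherever the Green function is finite. *)
have mono : {ae mu, forall x, forall k n, (1 <= n)%N -> r k 1%N x <= r k n x}.
  apply: ae_foralln => k; apply: ae_foralln => n.
  have [n1|n1] := boolP (1 <= n)%N; last by apply: aeW.
  have H x : 0 <= fn 1%N x <= fn n x.
    rewrite fn0 /= /fn le_min ge_min lexx /= ge_min; apply/orP; right.
    by rewrite ler_nat.
  apply: filterS (resolvent_le ndfE (al0 k) (lexx _) (fnL n) (fnL 1%N) H) => x /andP[_ K] _.
  exact: K.
(* A countable cover, up to a null set, of the set to be shown null, with a single [m] as lower
   bound, upper bound and starting index, as [cutoffs_null] expects. *)
pose B m := [set x | m.+1%:R^-1 <= fn 1%N x] `&`
  \bigcap_(k in [set k | (m <= k)%N]) [set x | r k 1%N x <= m%:R].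
have mB m : measurable (B m).
  apply: measurableI.
    rewrite -[X in measurable X]setTI -preimage_itvcy; have [+ _] := fnL 1%N.
    by move=> mf1; exact: mf1.
  apply: bigcap_measurableType => k _.
  by rewrite -[X in measurable X]setTI -preimage_itvNyc; exact: mr.
have B0 m : mu (B m) = 0%E.
  apply: (@cutoffs_null (fn 1%N) m) => //.
  (* Chebyshev's inequality in [L2]: [B m] has finite measure. *)
  - have [mf1 fin1] := fnL 1%N.
    have c0 : 0 < m.+1%:R^-1 ^+ 2 :> R by rewrite exprn_gt0// invr_gt0.
    rewrite -(@lte_pmul2l _ (m.+1%:R^-1 ^+ 2)%:E) ?lte_fin// mulry gtr0_sg// mul1e.
    apply: le_lt_trans fin1; rewrite -(integral_scale_indic mu (mB m) (ltW c0)).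
    apply: ge0_le_integral => //.
    + by apply/measurable_EFinP; exact: measurable_scale_indic.
    + by apply/measurable_EFinP; exact: measurable_funX.
    move=> x _; rewrite lee_fin indicE; have [/set_mem[/= Bx _]|_] := boolP (x \in B m).
      by rewrite mulr1 ler_sqr ?nnegrE// ?invr_ge0.
    by rewrite mulr0 sqr_ge0.
  - by move=> x [].
  - by move=> x k [_ Bx] mk; exact: Bx.
have [N [mN N0 sN]] := mono.
apply: (@negligibleS _ _ _ _ (\bigcup_m B m `|` N)); last first.
  apply: negligibleU; last by exists N; split.
  by apply: negligible_bigcup => m; exists (B m); split.
move=> x [/= fx gx]; have [xN|xN] := pselect (N x); [by right|left].
have M : forall k n, (1 <= n)%N -> r k 1%N x <= r k n x.
  by apply: contrapT => nM; apply: xN; exact: sN.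
have [K [C HC]] : exists (K : nat) (C : R), forall k, (K <= k)%N -> ((r k 1%N x)%:E <= C%:E)%E.
  apply: limn_esup_lt; apply: le_lt_trans gx.
  apply: (@le_limn_esup _ _ _ 0%N) => k _.
  by apply: (@limn_esup_ge _ _ _ 1%N) => n n1; rewrite lee_fin; exact: M.
have f1x : 0 < fn 1%N x by rewrite lt_min fx ltr01.
pose m := maxn K (maxn (Num.truncn C).+1 (Num.truncn (fn 1%N x)^-1).+1).
have mC : C <= m%:R.
  apply: ltW; apply: lt_le_trans (truncnS_gt C) _.
  by rewrite ler_nat !leq_max leqnn orbT.
have mf1 : (fn 1%N x)^-1 <= m.+1%:R.
  apply: ltW; apply: lt_le_trans (truncnS_gt _) _.
  by rewrite ler_nat ltnW// ltnS !leq_max leqnn !orbT.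
exists m => //; split=> /=.
  by rewrite -[leRHS]invrK lef_pV2 ?posrE ?invr_gt0.
move=> k /= mk; rewrite -lee_fin; apply: (@le_trans _ _ C%:E); last by rewrite lee_fin.
by apply: HC; apply: leq_trans mk; rewrite leq_maxl.
Qed.

End cutoffs.

(** * Cutoffs, Luxemburg seminorms and the relaxed form *)

Section characterizations.
Context (d : measure_display) (T : measurableType d) (R : realType).
Variables (mu : {measure set T -> \bar R}) (E : (T -> R) -> \bar R).
Hypothesis ndfE : nonlinear_Dirichlet_form mu E.

Lemma ndf_scale_le (a b : R) (u : T -> R) : 0 < a -> a <= b ->
  (E (fun x => (a * u x)%R) <= (a / b)%:E * E (fun x => (b * u x)%R))%E.
Proof.
move=> a0 ab; have b0 : 0 < b by apply: lt_le_trans ab.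
have t01 : 0 <= a / b <= 1.
  by rewrite divr_ge0 ?(ltW a0) ?(ltW b0)//= ler_pdivrMr// mul1r.
apply: le_trans (ndf_scale ndfE (fun x => b * u x) t01).
rewrite le_eqVlt; apply/orP; left; apply/eqP; congr E; apply/funext => x.
by rewrite mulrA divfK// gt_eqF.
Qed.

Lemma clamp_lipschitz (l a b : R) : 0 <= l ->
  `|Num.max 0 (Num.min a l) - Num.max 0 (Num.min b l)| <= `|a - b|.
Proof.
move=> l0; have h1 := ler_norm (a - b); have h2 := ler_norm (b - a).
rewrite distrC in h2; rewrite ler_norml.
by have [?|?] := leP a l; have [?|?] := leP b l; rewrite ?(max_idPr l0) ?subrr;
  try (have [?|?] := leP 0 a); try (have [?|?] := leP 0 b);
  apply/andP; split; lra.
Qed.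

(** Clamp [u] to [[0, 1]]. Then [lam * v] is a contraction of [lam * u], convexity gains the factor
    [lam * l] over the energy at scale [l^-1], and the distance to 1 does not grow because 1 is
    fixed by the clamp. *)
Lemma clamp_cutoff (lam eps l K : R) (u : T -> R) (A : set T) : 0 < lam -> 0 < l ->
  lam * l <= 1 -> lam * l * K <= eps -> measurable A ->
  (E (fun x => (l^-1 * u x)%R) <= K%:E)%E ->
  (mu (A `&` [set x | (eps < `|u x - 1|)%R]) <= eps%:E)%E ->
  exists v : T -> R, [/\ measurable_fun setT v, forall x, 0 <= v x <= 1,
    (E (fun x => (lam * v x)%R) <= eps%:E)%E &
    (mu (A `&` [set x | (eps < `|v x - 1|)%R]) <= eps%:E)%E].
Proof.
move=> lam0 l0 laml lK mA Eu Au.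
have mu_ : measurable_fun setT u.
  have [|m _] := @ndf_lty_L2 _ _ _ _ _ ndfE (fun x => l^-1 * u x).
    by apply: le_lt_trans Eu _; exact: ltry.
  have : measurable_fun setT (fun x => l * (l^-1 * u x)) by exact: measurable_funM.
  by congr measurable_fun; apply/funext => x; rewrite mulrA divff ?mul1r// gt_eqF.
pose v x := Num.max 0 (Num.min (u x) 1).
have mv : measurable_fun setT v by apply: measurable_maxr => //; exact: measurable_minr.
exists v; split=> //.
- by move=> x; rewrite le_max lexx /= ge_max ler01 /= ge_min lexx orbT.
- apply: (@le_trans _ _ (E (fun x => lam * u x)%R)).
    rewrite (_ : (fun x => lam * v x) =
        (fun x => Num.max 0 (Num.min (lam * u x) lam))); last first.
      by apply/funext => x; rewrite /v maxr_pMr ?(ltW lam0)// minr_pMr ?(ltW lam0)// mulr0 mulr1.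
    apply: (ndf_contraction ndfE (fun x => lam * u x)
      (C := fun y => Num.max 0 (Num.min y lam))).
      by move=> a b; apply: clamp_lipschitz; exact: ltW.
    by rewrite /= (min_idPl (ltW lam0)) maxxx.
  have lamV : lam <= l^-1 by rewrite -[l^-1]mul1r ler_pdivlMr.
  apply: le_trans (ndf_scale_le _ lam0 lamV) _; rewrite invrK.
  apply: (@le_trans _ _ ((lam * l)%:E * K%:E)%E).
    by apply: lee_wpmul2l => //; rewrite lee_fin mulr_ge0// ltW.
  by rewrite -EFinM lee_fin.
- apply: le_trans Au; apply: le_measure; rewrite ?inE.
  + apply: measurableI => //; rewrite -[X in measurable X]setTI -preimage_itvoy.
    by apply: measurableT_comp => //; exact: measurable_funB.
  + apply: measurableI => //; rewrite -[X in measurable X]setTI -preimage_itvoy.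
    by apply: measurableT_comp => //; exact: measurable_funB.
  move=> x [Ax /= ev]; split=> //=; apply: (lt_le_trans ev).
  rewrite -[X in `|_ - X| <= _](_ : Num.max 0 (Num.min 1 1) = 1 :> R); last first.
    by rewrite minxx; apply/max_idPr.
  exact: clamp_lipschitz.
Qed.

Lemma ltr_scale_dist (eps l a b : R) : 0 < l ->
  (eps / l < `|a - b|) = (eps < `|l * a - l * b|).
Proof. by move=> l0; rewrite -mulrBr normrM gtr0_norm// ltr_pdivrMr// mulrC. Qed.

Lemma luxemburg_lt (F : (T -> R) -> \bar R) (u : T -> R) (e : R) :
  (luxemburg F u < e%:E)%E ->
  exists l, [/\ 0 < l, l < e & (F (fun x => (l^-1 * u x)%R) <= 1)%E].
Proof.
by move=> /ereal_inf_lt[_ [l [l0 Fl] <-]]; rewrite lte_fin => le; exists l.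
Qed.

Lemma luxemburg_cutoffs (e : nat -> T -> R) :
  loc_cvg_meas mu e (fun=> 1) -> (fun n => luxemburg E (e n)) @ \oo --> 0%E ->
  cutoffs mu E.
Proof.
move=> ce le lam eps A lam0 eps0 mA Afin.
(* A scale [l < b] gives both [lam * l <= 1] and [lam * l <= eps]. *)
pose b := Num.min 1 eps / lam.
have b0 : 0 < b by rewrite divr_gt0// lt_min ltr01.
have [N HN] := cvge0_small le b0.
have [M HM] := cvge0_small (ce A mA Afin eps eps0) eps0.
pose n := maxn N M.
have [l [l0 lb El]] := luxemburg_lt (HN n (leq_maxl _ _)).
have laml : lam * l <= Num.min 1 eps by rewrite mulrC -ler_pdivlMr// ltW.
apply: (@clamp_cutoff lam eps l 1 (e n)) => //.
- by apply: le_trans laml _; rewrite ge_min lexx.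
- by rewrite mulr1; apply: le_trans laml _; rewrite ge_min lexx orbT.
- by apply: ltW; exact: HM (leq_maxr _ _).
Qed.

(** A relaxed energy at most 1 at the constant [l^-1] yields functions near [l^-1] of energy below
    2; multiplied by [l] they are near 1. *)
Lemma ext_luxemburg_cutoffs : luxemburg (ext_form mu E) (fun=> 1) = 0%E -> cutoffs mu E.
Proof.
move=> L0 lam eps A lam0 eps0 mA Afin.
pose b := Num.min 1 (eps / 2) / lam.
have b0 : 0 < b by rewrite divr_gt0// lt_min ltr01 divr_gt0.
have [|l [l0 lb El]] := @luxemburg_lt (ext_form mu E) (fun=> 1) b; first by rewrite L0 lte_fin.
have laml : lam * l <= Num.min 1 (eps / 2) by rewrite mulrC -ler_pdivlMr// ltW.
have : (ext_form mu E (fun=> (l^-1 * 1)%R) < 2%:E)%E.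
  by apply: le_lt_trans El _; rewrite lte_fin ltr1n.
move=> /ereal_inf_lt[_ [u [mu_ cu] <-] Hu].
(* The tolerance [eps / l] around [l^-1] becomes [eps] around 1 after multiplication by [l]. *)
have [M HM] := cvge0_small (cu A mA Afin (eps / l) (divr_gt0 eps0 l0)) eps0.
have [n Mn Eun] := limn_einf_lt M Hu.
apply: (@clamp_cutoff lam eps l 2 (fun x => l * u n x)) => //.
- by apply: le_trans laml _; rewrite ge_min lexx.
- have : lam * l <= eps / 2 by apply: le_trans laml _; rewrite ge_min lexx orbT.
  lra.
- rewrite (_ : (fun x => _) = u n); first exact: ltW.
  by apply/funext => x; rewrite mulrA mulVf ?mul1r// gt_eqF.
- apply: ltW; apply: le_lt_trans (HM n Mn).
  rewrite le_eqVlt; apply/orP; left; apply/eqP; congr (mu (A `&` _)).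
  by apply/funext => x; rewrite /= ltr_scale_dist// mulr1 divff ?gt_eqF.
Qed.

(** A diagonal choice: scale [n + 1], precision [1 / (n + 1)], and the [n]-th set of an increasing
    exhaustion by sets of finite measure. *)
Lemma cutoffs_sequence : sigma_finite setT mu -> cutoffs mu E ->
  exists v : nat -> T -> R, [/\ forall n, measurable_fun setT (v n),
    forall n x, 0 <= v n x <= 1, loc_cvg_meas mu v (fun=> 1) &
    forall n, (E (fun x => (n.+1%:R * v n x)%R) <= (n.+1%:R^-1)%:E)%E].
Proof.
move=> /sigma_finite_nondecreasing[A [mA Afin ndA AT]] Q.
have /choice[v Hv] (n : nat) : exists v : T -> R, [/\ measurable_fun setT v,
    forall x, 0 <= v x <= 1, (E (fun x => (n.+1%:R * v x)%R) <= (n.+1%:R^-1)%:E)%E &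
    (mu (A n `&` [set x | (n.+1%:R^-1 < `|v x - 1|)%R]) <= (n.+1%:R^-1)%:E)%E].
  by apply: Q; rewrite ?invr_gt0.
have mv n : measurable_fun setT (v n) by have [] := Hv n.
exists v; split; [by []|by move=> n; have [] := Hv n| |by move=> n; have [] := Hv n].
move=> B mB Bfin eps eps0; apply: cvge0_eps => // e e0.
have e20 : 0 < e / 2 by lra.
have cBA : mu (B `\` A n) @[n --> \oo] --> 0%E.
  rewrite -(measure0 mu) (_ : set0 = \bigcap_n (B `\` A n)); last first.
    apply/seteqP; split=> // x Bx; have : [set: T] x by [].
    by rewrite -AT => -[n _ Anx]; have [_] := Bx n I.
  apply: (@nonincreasing_cvg_mu _ _ _ mu (fun n => B `\` A n)).
  - apply: le_lt_trans Bfin; apply: le_measure; rewrite ?inE//; exact: measurableD.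
  - by move=> n; exact: measurableD.
  - by apply: bigcapT_measurable => n; exact: measurableD.
  - move=> m n mn; apply/subsetPset => x [Bx nA]; split=> // Am; apply: nA.
    by move/subsetPset: (ndA m n mn); apply.
have [N1 H1] := cvge0_small cBA e20.
have me0 : 0 < Num.min eps (e / 2) by rewrite lt_min eps0.
have /cvgrPdist_le/(_ _ me0)[N2 _ H2] := @cvg_harmonic R.
exists (maxn N1 N2) => n; rewrite geq_max => /andP[n1 n2].
have := H2 n n2; rewrite sub0r normrN /= ger0_norm ?invr_ge0// le_min => /andP[ne ne2].
have [_ _ _ Hn] := Hv n.
have mS (r : R) C : measurable C -> measurable (C `&` [set x | (r < `|v n x - 1|)%R]).
  move=> mC; apply: measurableI => //; rewrite -[X in measurable X]setTI -preimage_itvoy.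
  by apply: measurableT_comp => //; exact: measurable_funB.
apply: (@le_trans _ _ (mu (B `\` A n) +
    mu (A n `&` [set x | (n.+1%:R^-1 < `|v n x - 1|)%R]))%E).
  apply: le_measureU2; [exact: measurableD|exact: mS|exact: mS|].
  move=> x [Bx /= ex]; have [Ax|nAx] := pselect (A n x); [right|by left].
  by split=> //=; exact: le_lt_trans ne ex.
rewrite (splitr e) EFinD; apply: leeD; first by apply: ltW; exact: H1.
by apply: le_trans Hn _; rewrite lee_fin.
Qed.

(** * Seminorm and modular estimates along a sequence of cutoffs *)

Section sequence.
Variable v : nat -> T -> R.
Hypotheses (mv : forall n, measurable_fun setT (v n)) (cv : loc_cvg_meas mu v (fun=> 1))
  (Ev : forall n, (E (fun x => (n.+1%:R * v n x)%R) <= (n.+1%:R^-1)%:E)%E).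

(** The bound [lam] is for [lam] tending to 0 at fixed [n], the bound [1 / (n + 1)] for [n] tending
    to infinity at fixed [lam]. *)
Lemma scaled_energy_le (lam : R) (n : nat) : 0 < lam -> lam <= n.+1%:R ->
  (E (fun x => (lam * v n x)%R) <= (Num.min lam n.+1%:R^-1)%:E)%E.
Proof.
move=> lam0 ln; apply: le_trans (ndf_scale_le _ lam0 ln) _.
have n0 : 0 < n.+1%:R :> R by [].
have t0 : 0 <= lam / n.+1%:R by rewrite divr_ge0// ltW.
apply: (@le_trans _ _ ((lam / n.+1%:R)%:E * (n.+1%:R^-1)%:E)%E).
  by apply: lee_wpmul2l => //; rewrite lee_fin.
rewrite -EFinM lee_fin le_min; apply/andP; split.
  have i1 : n.+1%:R^-1 <= 1 :> R by rewrite invf_le1// ler1n.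
  rewrite -mulrA ler_piMr// ?(ltW lam0)//.
  by rewrite mulr_ile1// invr_ge0.
by rewrite ler_piMl ?invr_ge0// ler_pdivrMr// mul1r.
Qed.

(** The functions [lam * v n] converge to [lam] with vanishing energy. The constant is written
    [lam * 1] to match the shape in [modular] and [luxemburg]. *)
Lemma ext_form_cst (lam : R) : 0 < lam -> ext_form mu E (fun=> (lam * 1)%R) = 0%E.
Proof.
move=> lam0; apply/eqP; rewrite eq_le; apply/andP; split; last first.
  apply: le_ereal_inf_tmp => _ [u _ <-]; apply: (@limn_einf_ge _ _ _ 0%N) => p _.
  exact: ndf_ge0 ndfE _.
apply/lee_addgt0Pr => e e0; rewrite add0e.
apply: (@le_trans _ _ (limn_einf (fun n => E (fun x => (lam * v n x)%R)))).
  apply: ereal_inf_lbound; exists (fun n x => lam * v n x) => //; split.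
    by move=> n; exact: measurable_funM.
  move=> A mA Afin eps eps0.
  rewrite (_ : (fun n => _) =
      fun n => mu (A `&` [set x | (eps / lam < `|v n x - 1|)%R])); last first.
    apply/funext => n; congr (mu (A `&` _)); apply/funext => x.
    by rewrite /= ltr_scale_dist.
  by apply: cv => //; exact: divr_gt0.
have /cvgrPdist_le/(_ _ e0)[N1 _ H1] := @cvg_harmonic R.
apply: (@limn_einf_le _ _ _ (maxn N1 (Num.truncn lam))) => n.
rewrite geq_max => /andP[n1 n2].
have ln : lam <= n.+1%:R.
  by apply: ltW; apply: lt_le_trans (truncnS_gt lam) _; rewrite ler_nat.
apply: le_trans (scaled_energy_le lam0 ln) _; rewrite lee_fin ge_min; apply/orP; right.
by have := H1 n n1; rewrite sub0r normrN /= ger0_norm ?invr_ge0.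
Qed.

Lemma modular_ext_form_1 : modular (ext_form mu E) (fun=> 1).
Proof.
rewrite /modular; apply: cvg_near_cst.
by near=> l; apply/eqP; rewrite ext_form_cst.
Unshelve. all: by end_near.
Qed.

Lemma luxemburg_ext_form_1 : luxemburg (ext_form mu E) (fun=> 1) = 0%E.
Proof.
apply/eqP; rewrite eq_le; apply/andP; split.
  apply/lee_addgt0Pr => e e0; rewrite add0e; apply: ereal_inf_lbound.
  by exists e => //; split=> //; rewrite ext_form_cst ?invr_gt0// lee_fin ler01.
by apply: le_ereal_inf_tmp => _ [l [l0 _] <-]; rewrite lee_fin ltW.
Qed.

Lemma modular_sequence (n : nat) : modular E (v n).
Proof.
rewrite /modular; apply: (@squeeze_cvge _ _ _ _ (fun=> 0%E) _ (fun l => l%:E)).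
- near=> l; rewrite (ndf_ge0 ndfE)/=.
  have l0 : 0 < l by [].
  have l1 : l <= n.+1%:R.
    apply: (@le_trans _ _ 1); last by rewrite ler1n.
    by near: l; exact: nbhs_right_le.
  by apply: le_trans (scaled_energy_le l0 l1) _; rewrite lee_fin ge_min lexx.
- exact: cvg_cst.
- apply: cvg_EFin; first exact: nearW.
  exact: cvg_at_right_filter.
Unshelve. all: by end_near.
Qed.

Lemma luxemburg_sequence : (fun n => luxemburg E (v n)) @ \oo --> 0%E.
Proof.
apply: (cvge0_squeeze (w := harmonic)); last exact: cvg_harmonic.
- by move=> n; apply: le_ereal_inf_tmp => _ [l [l0 _] <-]; rewrite lee_fin ltW.
- move=> n; apply: ereal_inf_lbound; exists n.+1%:R^-1 => //; split.
    by rewrite invr_gt0.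
  rewrite invrK; apply: le_trans (Ev n) _.
  by rewrite lee_fin invf_le1// ler1n.
Qed.

End sequence.
End characterizations.

Theorem theorem4p17 (d : measure_display) (T : measurableType d) (R : realType)
  (mu : {measure set T -> \bar R}) (E : (T -> R) -> \bar R) :
  sigma_finite setT mu ->
  nonlinear_Dirichlet_form mu E ->
  weak_Delta2 E ->
  [<-> critical mu E;
       modular (ext_form mu E) (fun _ => 1) /\
         luxemburg (ext_form mu E) (fun _ => 1) = 0%E;
       exists e : nat -> T -> R,
         [/\ (forall n, modular E (e n)),
             (forall n, {ae mu, forall x, 0 <= e n x <= 1}),
             loc_cvg_meas mu e (fun _ => 1) &
             (fun n => luxemburg E (e n)) @ \oo --> 0%E]].
Proof.
move=> sf ndfE _; tfae.
- move=> /(critical_cutoffs ndfE)/(cutoffs_sequence sf)[v [mv _ cv Ev]].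
  by split; [exact: (modular_ext_form_1 ndfE mv cv Ev)|exact: (luxemburg_ext_form_1 ndfE mv cv Ev)].
- move=> [_ /(ext_luxemburg_cutoffs ndfE)/(cutoffs_sequence sf)[v [mv v01 cv Ev]]].
  exists v; split=> //; first by move=> n; exact: (modular_sequence ndfE Ev).
    by move=> n; apply: aeW.
  exact: luxemburg_sequence Ev.
- by move=> [e [_ _ ce le]]; apply: (cutoffs_critical ndfE); exact: (luxemburg_cutoffs ndfE ce le).
Qed.
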